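(* Let $d\ge2$ and let $f:\mathbb{R}^d\to\mathbb{R}$ be bounded, Borel-measurable, with $\mathrm{supp}(f)\subset[0,1]^d$. Then the value function $U$ defined below is a Pareto-monotone viscosity solution of \[U_{x_1}\cdots U_{x_d}=\frac{1}{d^d}f\quad\text{on }\mathbb{R}^d.\] Furthermore: (i) whenever $\mathrm{supp}(f)\subset\{x:0\leqq x\leqq z\}$ for some $z\in\mathbb{R}^d$, we have $U(x_1,\dots,x_d)=U(\min(x_1,z_1),\dots,\min(x_d,z_d))$ for all $x\in\mathbb{R}^d_+$; (ii) $U(x)=0$ for every $x\in\mathbb{R}^d\setminus\mathbb{R}^d_+$.
   Context: For $x,y\in\mathbb{R}^d$, $x\leqq y$ means $x_i\le y_i$ for all $i$; $\mathbb{R}^d_+=\{x:x_i>0\ \forall i\}$. Let $\mathcal{A}$ be the set of $\gamma\in C^1([0,1];\mathbb{R}^d)$ such that for every $t$, all components of $\gamma'(t)$ are nonnegative and $\gamma'(t)\ne0$. $J(\gamma)=\int_0^1 f(\gamma(t))^{1/d}(\gamma_1'(t)\cdots\gamma_d'(t))^{1/d}\,dt$ and $U(x)=\sup\{J(\gamma):\gamma\in\mathcal{A},\ \gamma(1)\leqq x\}$. A function $u$ is Pareto-monotone if $x\leqq y$ implies $u(x)\le u(y)$. Superdifferential $D^+u(x)$: all $p$ with $u(y)\le u(x)+\langle p,y-x\rangle+o(|y-x|)$ as $y\to x$; subdifferential $D^-u(x)$: all $p$ with $u(y)\ge u(x)+\langle p,y-x\rangle+o(|y-x|)$. For bounded $g$,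 $g^*(x)=\limsup_{r\searrow0}\sup\{g(y):|x-y|\le r\}$ and $g_*=-(-g)^*$. A continuous $u$ is a viscosity solution of $u_{x_1}\cdots u_{x_d}=g$ on an open set $\mathcal O$ if for all $x\in\mathcal O$: $p_1\cdots p_d\le g^*(x)$ for all $p\in D^+u(x)$, and $p_1\cdots p_d\ge g_*(x)$ for all $p\in D^-u(x)$.
   Formalization: The formal theorem assumes in addition that f ≥ 0; without it f^{1/d} is undefined for even d, and for odd d the claim fails, e.g. for f = -1 on [0,1]^d, where U = 0 violates the superdifferential inequality. *)

(* Defs.v *)
From HB Require Import structures.
From mathcomp Require Import all_boot all_order all_algebra.
From mathcomp Require Import all_classical all_reals all_analysis.
Set Implicit Arguments.
Unset Strict Implicit.
Unset Printing Implicit Defensive.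
Import Order.TTheory GRing.Theory Num.Theory.
Import numFieldNormedType.Exports.
Local Open Scope classical_set_scope.
Local Open Scope ring_scope.

Section Defs.
Variables (R : realType) (d : nat).
Notation V := 'rV[R]_d.

Definition vle (x y : V) : Prop := forall i : 'I_d, x 0 i <= y 0 i.

Definition posorthant : set V := [set x | forall i : 'I_d, 0 < x 0 i].

Definition dotv (p q : V) : R := \sum_(i < d) p 0 i * q 0 i.
Definition enorm (v : V) : R := Num.sqrt (dotv v v).

Definition vmin (x z : V) : V := \row_(i < d) Num.min (x 0 i) (z 0 i).

Definition borel_fun (f : V -> R) : Prop :=
  forall B : set R, measurable B -> <<s open >> (f @^-1` B).

Definition sup_bounded (f : V -> R) : Prop := exists M : R, forall x, `|f x| <= M.

(* g' is the derivative of g on the closed interval [0,1] (one-sided at the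
   endpoints) and g' is continuous on [0,1]:  g ∈ C^1([0,1];R^d). *)
Definition C1_01 (g g' : R -> V) : Prop :=
  {within `[0, 1], continuous g'} /\
  forall t, t \in `[0, 1] ->
    (fun h : R => h^-1 *: (g (t + h) - g t))
      @ within [set h : R | t + h \in `[0, 1]] (0 : R)^' --> g' t.

Definition admissible (g g' : R -> V) : Prop :=
  C1_01 g g' /\
  forall t, t \in `[0, 1] -> (forall i : 'I_d, 0 <= g' t 0 i) /\ g' t != 0.

Definition Jfun (f : V -> R) (g g' : R -> V) : R :=
  \int[lebesgue_measure]_(t in `[0, 1]%classic)
     (powR (f (g t)) (d%:R^-1) * powR (\prod_(i < d) g' t 0 i) (d%:R^-1)).

Definition Uext (f : V -> R) (x : V) : \bar R :=
  ereal_sup [set r : \bar R | exists (g g' : R -> V),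
     [/\ admissible g g', vle (g 1) x & r = (Jfun f g g')%:E]].

(* real-valued value function (meaningful once Uext is shown finite) *)
Definition U (f : V -> R) (x : V) : R := fine (Uext f x).

Definition pareto_monotone (u : V -> R) : Prop :=
  forall x y, vle x y -> u x <= u y.

Definition superdiff (u : V -> R) (x : V) : set V :=
  [set p | forall eps : R, 0 < eps ->
     \forall y \near x, u y - u x - dotv p (y - x) <= eps * enorm (y - x)].

Definition subdiff (u : V -> R) (x : V) : set V :=
  [set p | forall eps : R, 0 < eps ->
     \forall y \near x, - (eps * enorm (y - x)) <= u y - u x - dotv p (y - x)].

(* upper envelope g^*(x) = limsup_{r↘0} sup{g(y) : |x-y| <= r}; since
   r |-> sup{g(y) : |x-y| <= r} is nondecreasing in r, this limsup is the
   infimum over r > 0. *)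
Definition usc_env (g : V -> R) (x : V) : R :=
  inf [set sup [set g y | y in [set y | enorm (x - y) <= r]] | r in [set r : R | 0 < r]].

Definition lsc_env (g : V -> R) (x : V) : R := - usc_env (fun y => - g y) x.

Definition viscosity_solution (u g : V -> R) (O : set V) : Prop :=
  [/\ continuous u, open O &
   forall x, O x ->
     (forall p, superdiff u x p -> \prod_(i < d) p 0 i <= usc_env g x) /\
     (forall p, subdiff u x p -> lsc_env g x <= \prod_(i < d) p 0 i)].
End Defs.

(* Main.v *)
Require Import Defs.
From HB Require Import structures.
From mathcomp Require Import all_boot all_order all_algebra.
From mathcomp Require Import all_classical all_reals all_analysis.
From mathcomp Require Import measurable_realfun ring lra.
Import Order.TTheory GRing.Theory Num.Theory.
Import numFieldNormedType.Exports.
Local Open Scope classical_set_scope.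
Local Open Scope ring_scope.
Set Implicit Arguments.
Unset Strict Implicit.
Unset Printing Implicit Defensive.

(* Two modifications of an admissible curve replace the concatenation of curves,
   which would break C^1 regularity.  Composing with a time change that is the
   identity up to time [a] and then slows down shows that the action of an initial
   piece of a curve is bounded by [U] at the end of the piece.  Adding
   [((t - a)^+ / (1 - a))^2 b] with [b >= 0] prolongs a curve by the vector [b] while
   changing it on [a, 1] only.
   The weighted AM-GM inequality
   [(prod_i g_i')^(1/d) <= (prod_i l_i)^(-1/d) (sum_i l_i g_i') / d]
   bounds the action of a final piece by the displacement.  With one large weight it
   gives the uniform continuity of [U], since a curve leaving [{y <= x}] but ending
   below [x + (h, .., h)] moves by at most [h] in some coordinate from then on.  With
   [l = p] in the superdifferential it gives the upper inequality, comparing [U] at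
   [x] and at the point where a nearly optimal curve enters [x - h, x].  For the lower
   inequality, curves ending at [x - h v] are prolonged by [h v], where [v] is
   nearly the vector of the [1 / p_i]. *)

(** * Curves of class C^1 *)

Section Curves.
Context {R : realType} {d : nat}.
Implicit Types (g dg : R -> 'rV[R]_d) (t s a b : R).

(** Multiplying the difference quotient by [u - t] gives a form that also holds at [u = t] and,
    one-sidedly, at the endpoints of [0, 1]. *)
Lemma C1_coord_expand g dg t (i : 'I_d) : C1_01 g dg -> t \in `[0, 1] ->
  forall e : R, 0 < e -> \forall u \near t, u \in `[0, 1] ->
    `|g u 0 i - g t 0 i - (u - t) * dg t 0 i| <= e * `|u - t|.
Proof.
move=> [_ gd] t01 e e0.
have /= := cvg_comp _ _ (gd t t01) (@coord_continuous R 1 d 0 i (dg t)).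
move/cvgrPdist_le => /(_ e e0).
rewrite near_withinE /= => /nbhs_ballP[r /= r0 H].
apply/nbhs_ballP; exists r => //= u tu u01.
have [->|ut] := eqVneq u t; first by rewrite !subrr mul0r subr0 normr0 mulr0.
have ut0 : u - t != 0 by rewrite subr_eq0.
have := H (u - t).
rewrite /= /ball /= sub0r normrN => /(_ _ ut0).
rewrite (addrC t) subrK => /(_ _ u01).
rewrite -[`|u - t|]normrN opprB => /(_ tu); rewrite !mxE => K.
have -> : g u 0 i - g t 0 i - (u - t) * dg t 0 i =
    - ((u - t) * (dg t 0 i - (u - t)^-1 * (g u 0 i - g t 0 i))) by field.
by rewrite [in leRHS]distrC normrN normrM [leLHS]mulrC ler_pM2r ?normr_gt0.
Qed.

Lemma C1_coord_continuous g dg (i : 'I_d) : C1_01 g dg ->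
  {within `[0, 1], continuous (fun t => g t 0 i)}.
Proof.
move=> C; apply/subspace_continuousP => t t01.
apply/cvgrPdist_le => e e0; rewrite near_withinE.
have k0 : 0 < e / (1 + `|dg t 0 i|) by rewrite divr_gt0 // ltr_pwDl.
have N1 := near_ball t _ k0.
have N2 := C1_coord_expand i C t01 ltr01.
near=> u => u01.
have /ltW : `|t - u| < e / (1 + `|dg t 0 i|) by near: u.
rewrite distrC => tu.
have : `|g u 0 i - g t 0 i - (u - t) * dg t 0 i| <= 1 * `|u - t|.
  by move: u01; near: u.
rewrite mul1r => H; rewrite distrC /=.
rewrite -[X in `|X|](subrK ((u - t) * dg t 0 i)).
apply: (le_trans (ler_normD _ _)); rewrite normrM.
apply: (le_trans (lerD H (lexx _))).
by rewrite -{1}[`|u - t|]mulr1 -mulrDr -ler_pdivlMr // ltr_pwDl.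
Unshelve. all: by end_near. Qed.

Lemma C1_coord_derivative_continuous g dg (i : 'I_d) : C1_01 g dg ->
  {within `[0, 1], continuous (fun t => dg t 0 i)}.
Proof.
move=> [/subspace_continuousP C _]; apply/subspace_continuousP => t /C Ct.
exact: (cvg_comp _ _ Ct (@coord_continuous R 1 d 0 i (dg t))).
Qed.

Lemma C1_is_derive g dg t (i : 'I_d) : C1_01 g dg -> t \in `]0, 1[ ->
  is_derive t 1 (fun u => g u 0 i) (dg t 0 i).
Proof.
move=> C t01.
have t01' : t \in `[0, 1] by apply: subset_itv_oo_cc.
have n01 : \forall u \near t, u \in `[0, 1].
  by move: (near_in_itvoo t01); apply: filterS => u; apply: subset_itv_oo_cc.
have cv : h^-1 *: (g (h *: 1 + t) 0 i - g t 0 i) @[h --> 0^'] --> dg t 0 i.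
  apply/cvgrPdist_le => e e0.
  have [r /= r0 H] : nbhs_ball t [set u | u \in `[0, 1] /\
      `|g u 0 i - g t 0 i - (u - t) * dg t 0 i| <= e * `|u - t|].
    apply/nbhs_ballP; move: (n01) (C1_coord_expand i C t01' e0).
    by apply: filterS2 => u u01 /(_ u01).
  apply/nbhs_ballP; exists r => //= h; rewrite /ball /= sub0r normrN => hr h0.
  have := H (h + t); rewrite /ball /= opprD addrCA subrr addr0 normrN.
  move=> /(_ hr) [_]; rewrite addrK scaler1 /=.
  have -> : g (h + t) 0 i - g t 0 i - h * dg t 0 i =
    - (h * (dg t 0 i - h^-1 * (g (h + t) 0 i - g t 0 i))) by field.
  by rewrite normrN normrM [leRHS]mulrC ler_pM2l // normr_gt0.
by apply: DeriveDef; [exact: cvgP cv | exact: cvg_lim cv].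
Qed.

Lemma C1_FTC g dg a b (i : 'I_d) : C1_01 g dg -> 0 <= a -> a <= b -> b <= 1 ->
  \int[lebesgue_measure]_(t in `[a, b]) dg t 0 i = g b 0 i - g a 0 i.
Proof.
move=> C a0 ab b1; move: ab; rewrite le_eqVlt => /predU1P[->|ab].
  by rewrite set_itv1 Rintegral_set1 subrr.
have sub : (`[a, b] : set R) `<=` `[0, 1] by apply: subset_itv; rewrite bnd_simp.
rewrite /Rintegral (@continuous_FTC2 R (fun t : R => dg t 0 i) (fun t => g t 0 i)) //.
- by apply: (continuous_subspaceW sub); exact: C1_coord_derivative_continuous C.
- have := continuous_subspaceW sub (C1_coord_continuous (i := i) C).
  move=> /(continuous_within_itvP _ ab)[_ ga gb]; split => // x xab.
  have x01 : x \in `]0, 1[ by apply: subset_itvW xab.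
  by have [] := C1_is_derive i C x01.
- move=> x xab.
  have x01 : x \in `]0, 1[ by apply: subset_itvW xab.
  by rewrite derive1E; have [] := C1_is_derive i C x01.
Qed.

Lemma admissible_mono g dg a b (i : 'I_d) : admissible g dg ->
  0 <= a -> a <= b -> b <= 1 -> g a 0 i <= g b 0 i.
Proof.
move=> [C dg0] a0 ab b1; rewrite -subr_ge0 -(C1_FTC i C) //.
apply: Rintegral_ge0 => x /=; rewrite in_itv /= => /andP[ax xb].
by apply: (dg0 x _).1; rewrite in_itv /= (le_trans a0) // (le_trans xb).
Qed.

Lemma C1_derivative_bounded g dg : C1_01 g dg ->
  exists B, forall t i, t \in `[0, 1] -> dg t 0 i <= B.
Proof.
move=> C.
have H (i : 'I_d) : exists B, forall t, t \in `[0, 1] -> dg t 0 i <= B.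
  have [c _ Hc] := EVT_max ler01 (C1_coord_derivative_continuous (i := i) C).
  by exists (dg c 0 i).
have [B HB] := choice H.
exists (\sum_i `|B i|) => t i t01; rewrite (bigD1 i) //=.
apply: (le_trans (HB i t t01)); rewrite -[leLHS]addr0 lerD // ?ler_norm //.
exact: sumr_ge0.
Qed.

(** One side suffices: the derivative at [t], possibly an endpoint, is tested at points between [s]
    and [t]. *)
Lemma C1_coord_const_derivative g dg s t (i : 'I_d) : C1_01 g dg ->
  s \in `[0, 1] -> t \in `[0, 1] -> s != t ->
  (forall u, Num.min s t <= u <= Num.max s t -> g u 0 i = g t 0 i) ->
  dg t 0 i = 0.
Proof.
move=> C s01 t01 st H; apply/eqP; rewrite -normr_le0; apply/ler_addgt0Pr => e e0.
rewrite add0r.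
have [r /= r0 K] : nbhs_ball t [set u | u \in `[0, 1] ->
      `|g u 0 i - g t 0 i - (u - t) * dg t 0 i| <= e * `|u - t|].
  by apply/nbhs_ballP; exact: C1_coord_expand.
have st0 : 0 < `|s - t| by rewrite normr_gt0 subr_eq0.
(* The test point [t + q * (s - t)] must lie between [s] and [t] and within [r] of [t]. *)
pose q := Num.min 1 (r / 2 / `|s - t|).
have q0 : 0 < q by rewrite lt_min ltr01 /= !divr_gt0.
have q1 : q <= 1 by rewrite ge_min lexx.
have qr : q * `|s - t| < r.
  have : q <= r / 2 / `|s - t| by rewrite ge_min lexx orbT.
  rewrite ler_pdivlMr // => /le_lt_trans; apply; lra.
pose u := t + q * (s - t).
have ubetw : Num.min s t <= u <= Num.max s t.
  by rewrite /u; case: (ltP s t) => ?; apply/andP; split; nra.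
have u01 : u \in `[0, 1].
  move: s01 t01; rewrite !in_itv /= /u => /andP[? ?] /andP[? ?].
  by apply/andP; split; nra.
have := K u; rewrite /ball /= distrC /u [t + _]addrC addrK normrM (gtr0_norm q0).
move=> /(_ qr); rewrite [_ + t]addrC -/u => /(_ u01).
rewrite H // subrr sub0r normrN normrM normrM (gtr0_norm q0).
by rewrite mulrC ler_pM2r // mulr_gt0.
Qed.

End Curves.

(** * Modifications of admissible curves *)

Section Modify.
Context {R : realType} {d : nat}.
Implicit Types (g dg : R -> 'rV[R]_d) (t s a b : R).

(** A primitive of [(t - a)^+]. Being C^1, it gives time changes and pushes that start at [a]
    without a corner. *)
Definition halfsq_plus a t : R := Num.max (t - a) 0 ^+ 2 / 2.

Lemma is_derive_halfsq_plus a t :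
  is_derive t 1 (halfsq_plus a) (Num.max (t - a) 0).
Proof.
have cv : h^-1 *: (halfsq_plus a (h *: 1 + t) - halfsq_plus a t) @[h --> 0^']
    --> Num.max (t - a) 0.
  apply/cvgrPdist_le => e e0; apply/nbhs_ballP; exists e => //= h.
  rewrite /ball /= sub0r normrN scaler1 /halfsq_plus => he h0.
  set u := Num.max (t - a) 0; set v := Num.max (h + t - a) 0.
  have -> : u - h^-1 *: (v ^+ 2 / 2 - u ^+ 2 / 2) =
      h^-1 * (h * u - (v ^+ 2 - u ^+ 2) / 2).
    by rewrite /GRing.scale /=; field.
  rewrite normrM normfV mulrC ler_pdivrMr ?normr_gt0 //.
  suff H : `|h * u - (v ^+ 2 - u ^+ 2) / 2| <= `|h| ^+ 2.
    by rewrite (le_trans H) // expr2 ler_wpM2r // ltW.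
  rewrite real_normK ?num_real // ler_norml /u /v.
  by case: (leP (t - a) 0) => ?; case: (leP (h + t - a) 0) => ?;
    apply/andP; split; nra.
by apply: DeriveDef; [exact: cvgP cv | exact: cvg_lim cv].
Qed.

Lemma continuous_plus a : continuous (fun t => Num.max (t - a) 0).
Proof.
move=> t; apply: (@continuous_max _ _ (fun t => t - a) (cst 0));
  last exact: cst_continuous.
by apply: cvgB; [exact: cvg_id | exact: cvg_cst].
Qed.

Lemma is_derive_quotient (r dr : R -> R) t : is_derive t 1 r (dr t) ->
  h^-1 * (r (t + h) - r t) @[h --> 0^'] --> dr t.
Proof.
move=> [rt <-].
have -> : (fun h => h^-1 * (r (t + h) - r t)) =
    (fun h => h^-1 *: ((r \o shift t) (h *: 1) - r t)).
  by apply/funext => h; rewrite scaler1 /= [t + h]addrC.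
by rewrite /derive; exact: rt.
Qed.

(** The common form of braking and pushing. Injectivity of [r] keeps the inner increment [k h]
    nonzero, so the difference quotient of the composition factors; [0 < dr] keeps the new
    derivative nonzero. *)
Lemma admissible_reparam_add g dg (r dr q dq : R -> R) (b : 'rV[R]_d) :
  admissible g dg ->
  (forall t, t \in `[0, 1] -> r t \in `[0, 1]) -> injective r ->
  (forall t, is_derive t 1 r (dr t)) -> continuous dr ->
  (forall t, 0 < dr t) ->
  (forall t, is_derive t 1 q (dq t)) -> continuous dq ->
  (forall t, 0 <= dq t) -> (forall i, 0 <= b 0 i) ->
  admissible (fun t => g (r t) + q t *: b)
             (fun t => dr t *: dg (r t) + dq t *: b).
Proof.
move=> [[/subspace_continuousP cg gd] dg0] r01 rinj rd cdr dr0 qd cdq dq0 b0.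
have rc t : r x @[x --> t] --> r t.
  apply: differentiable_continuous; apply/derivable1_diffP.
  by have [] := rd t.
have W (F : set_system R) (D : set R) (f : R -> R) l :
    Filter F -> f @ F --> l -> f @ within D F --> l.
  by move=> FF fl; apply: cvg_trans fl; apply: cvg_fmap2; apply: cvg_within.
split; [split|] => [|t t01|t t01].
- apply/subspace_continuousP => t t01; apply: cvgD; last first.
    by apply: cvgZl => //; apply: W; exact: cdq.
  apply: cvgZ; first by apply: W; exact: cdr.
  have rw : r x @[x --> within `[0, 1] (nbhs t)] --> within `[0, 1] (nbhs (r t)).
    move=> A H; have := rc t _ H; rewrite /= !nbhs_simpl /= /within /=.
    by apply: filterS => u /= + u01; apply; exact: r01.
  exact: (cvg_comp _ _ rw (cg _ (r01 t t01))).
- pose k h := r (t + h) - r t.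
  have kn0 h : h != 0 -> k h != 0.
    apply: contra_neq => /eqP; rewrite subr_eq0 => /eqP /rinj /eqP.
    by rewrite -subr_eq0 addrAC subrr add0r => /eqP.
  have -> : (fun h => h^-1 *: (g (r (t + h)) + q (t + h) *: b - (g (r t) + q t *: b)))
     = (fun h => (h^-1 * k h) *: ((k h)^-1 *: (g (r t + k h) - g (r t)))
          + (h^-1 * (q (t + h) - q t)) *: b).
    apply/funext => h; rewrite scalerA {2}/k [r t + _]addrC subrK.
    have [->|h0] := eqVneq h 0.
      by rewrite /k addr0 !subrr !invr0 !mul0r !scale0r add0r.
    rewrite mulfK ?kn0 // -scalerA -scalerDr; congr (_ *: _).
    by rewrite scalerBl opprD addrACA.
  apply: cvgD; last first.
    by apply: cvgZl => //; apply: W; exact: is_derive_quotient.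
  apply: cvgZ; first by apply: W; exact: is_derive_quotient.
  have kw : k h @[h --> within [set h | t + h \in `[0, 1]] 0^'] -->
      within [set h | r t + h \in `[0, 1]] 0^'.
    have k0 : k h @[h --> 0] --> 0.
      rewrite -[X in _ --> X](subrr (r t)); apply: cvgB; last exact: cvg_cst.
      have th : t + h @[h --> (0 : R)] --> t.
        by rewrite -[X in _ --> X]addr0; apply: cvgD; [exact: cvg_cst | exact: cvg_id].
      exact: (cvg_comp _ _ th (rc t)).
    move=> A H; have := k0 _ H; rewrite /= !nbhs_simpl /= /within /=.
    move=> K; rewrite /prop_near1 /dnbhs nbhs_simpl /=.
    apply: filterS K => h /= K h0 h01.
    by apply: K; [exact: kn0 | rewrite /k addrC subrK; exact: r01].
  exact: (cvg_comp _ _ kw (gd _ (r01 t t01))).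
- have t01' := r01 t t01; have [g0 gn0] := dg0 _ t01'.
  have H i : 0 <= (dr t *: dg (r t)) 0 i by rewrite mxE mulr_ge0 // ltW.
  have H' i : 0 <= (dq t *: b) 0 i by rewrite mxE mulr_ge0.
  split=> [i|]; first by rewrite mxE addr_ge0.
  apply: contra_neq gn0 => /rowP E; apply/rowP => i; have := E i.
  rewrite mxE [RHS]mxE => /eqP; rewrite paddr_eq0 // => /andP[+ _].
  by rewrite !mxE mulf_eq0 gt_eqF //= => /eqP.
Qed.

Lemma halfsq_plus_le a t : t <= a -> halfsq_plus a t = 0.
Proof. by move=> ta; rewrite /halfsq_plus max_r ?subr_le0 // expr0n mul0r. Qed.

Lemma halfsq_plus_ge a t : a <= t -> halfsq_plus a t = (t - a) ^+ 2 / 2.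
Proof. by move=> ta; rewrite /halfsq_plus max_l ?subr_ge0. Qed.

(** The derivative [(t - a)^+ - (t - c)^+] never exceeds [c - a]. *)
Lemma halfsq_plus_lip a c s t : a <= c -> s <= t ->
  halfsq_plus a t - halfsq_plus c t - (halfsq_plus a s - halfsq_plus c s)
    <= (c - a) * (t - s).
Proof.
move=> ac st.
have [|] := leP t a; have [|] := leP s a; have [|] := leP t c; have [|] := leP s c;
  move=> h1 h2 h3 h4; rewrite ?(halfsq_plus_le h1) ?(halfsq_plus_le h2)
    ?(halfsq_plus_le h3) ?(halfsq_plus_le h4) ?(halfsq_plus_ge (ltW h1))
    ?(halfsq_plus_ge (ltW h2)) ?(halfsq_plus_ge (ltW h3)) ?(halfsq_plus_ge (ltW h4));
  nra.
Qed.

(* The time change has slope 1 up to [a], then brakes linearly to the slope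
   [(s - a) / 2], so that it has not passed [s] at time 1. *)
Lemma admissible_brake g dg a s : admissible g dg -> 0 <= a -> a < s -> s <= 1 ->
  exists g2 dg2, [/\ admissible g2 dg2, vle (g2 1) (g s) &
    forall t, t <= a -> g2 t = g t /\ dg2 t = dg t].
Proof.
move=> adm a0 as_ s1.
pose e := (s - a) / 2; have e0 : 0 < e by rewrite /e; lra.
pose c := a + e.
have ac : a < c by rewrite /c; lra.
have cs : c < s by rewrite /c /e; lra.
have e1 : e <= 1 / 2 by rewrite /e; lra.
(* With this [k] the slope decreases from 1 at [a] to [1 - k * e = e] at [c] and stays there, hence
   remains positive. *)
pose k := (1 - e) / e.
have k0 : 0 < k by rewrite divr_gt0 //; lra.
have ke : k * e = 1 - e by rewrite /k; field; rewrite gt_eqF.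
pose r t := t - k * (halfsq_plus a t - halfsq_plus c t).
pose dr t := 1 - k * (Num.max (t - a) 0 - Num.max (t - c) 0).
have dr0 t : 0 < dr t.
  have : Num.max (t - a) 0 - Num.max (t - c) 0 <= e.
    rewrite /c; case: (leP (t - a) 0) => ?; case: (leP (t - (a + e)) 0) => ?; lra.
  by move/(ler_wpM2l (ltW k0)); rewrite ke /dr; lra.
have rmono t u : t < u -> r t < r u.
  move=> tu; have := halfsq_plus_lip (ltW ac) (ltW tu).
  have -> : c - a = e by rewrite /c; lra.
  move/(ler_wpM2l (ltW k0)); rewrite mulrA ke /r; nra.
have rid t : t <= a -> r t = t.
  move=> ta; rewrite /r !halfsq_plus_le ?subrr ?mulr0 ?subr0 //.
  exact: le_trans (ltW ac).
have r1 : r 1 <= s.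
  rewrite /r !halfsq_plus_ge; [|lra|lra].
  have -> : (1 - a) ^+ 2 / 2 - (1 - c) ^+ 2 / 2 = e * (1 - (a + c) / 2).
    by rewrite /c; field.
  by rewrite mulrA ke /c /e; nra.
have rle t u : t <= u -> r t <= r u.
  by rewrite le_eqVlt => /predU1P[->//|/rmono/ltW].
have r01 t : t \in `[0, 1] -> r t \in `[0, 1].
  rewrite !in_itv /= => /andP[t0 t1]; apply/andP; split.
    by rewrite -(rid _ a0); exact: rle.
  exact: le_trans (rle _ _ t1) (le_trans r1 s1).
have rinj : injective r.
  move=> t u E; apply/eqP; case: (ltgtP t u) => // /rmono; by rewrite E ltxx.
have rd t : is_derive t 1 r (dr t).
  have H1 := is_derive_halfsq_plus a t; have H2 := is_derive_halfsq_plus c t.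
  have := is_deriveB (is_derive_id t 1) (is_deriveZ k (is_deriveB H1 H2)).
  by [].
have cdr : continuous dr.
  move=> t; apply: cvgB; first exact: cvg_cst.
  apply: cvgM; first exact: cvg_cst.
  by apply: cvgB; exact: continuous_plus.
exists (fun t => g (r t) + 0 *: 0), (fun t => dr t *: dg (r t) + 0 *: 0).
split.
- apply: (@admissible_reparam_add _ _ r dr (cst 0) (cst 0)) => // [t|i].
    exact: cst_continuous.
  by rewrite mxE.
- move=> i; rewrite scale0r addr0; apply: (admissible_mono i adm) => //.
  by have := r01 1; rewrite !in_itv /= ler01 lexx => /(_ isT) /andP[].
- move=> t ta; rewrite scale0r !addr0 rid //; split => //.
  rewrite /dr !max_r ?subrr ?mulr0 ?subr0 ?scale1r //; lra.
Qed.

(** For [a < 1], the square of [(t - a)^+ / (1 - a)]: a C^1 passage from 0 at time [a] to 1 at time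
    1, with derivative [dpush a]. *)
Definition push a t : R := 2 / (1 - a) ^+ 2 * halfsq_plus a t.
Definition dpush a t : R := 2 / (1 - a) ^+ 2 * Num.max (t - a) 0.

Lemma dpush_ge0 a t : 0 <= dpush a t.
Proof. by rewrite mulr_ge0 ?divr_ge0 ?sqr_ge0 // le_max lexx orbT. Qed.

Lemma push_le a t : t <= a -> push a t = 0.
Proof. by move=> ta; rewrite /push halfsq_plus_le ?mulr0. Qed.

Lemma push1 a : a < 1 -> push a 1 = 1.
Proof.
move=> a1; rewrite /push halfsq_plus_ge ?(ltW a1) //; field.
by rewrite subr_eq0 gt_eqF.
Qed.

Lemma is_derive_push a t : is_derive t 1 (push a) (dpush a t).
Proof. exact: (is_deriveZ _ (is_derive_halfsq_plus a t)). Qed.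

Lemma continuous_dpush a : continuous (dpush a).
Proof.
by move=> t; apply: cvgM; [exact: cvg_cst | exact: continuous_plus].
Qed.

Lemma dpush_integral a : a < 1 ->
  \int[lebesgue_measure]_(t in `[a, 1]) dpush a t = 1.
Proof.
move=> a1; rewrite /Rintegral (@continuous_FTC2 R (dpush a) (push a)) //.
- by rewrite /= push1 // push_le // subr0.
- apply: continuous_subspaceT; exact: continuous_dpush.
- have cp : continuous (push a).
    move=> t; apply: differentiable_continuous; apply/derivable1_diffP.
    by have [] := is_derive_push a t.
  split; first by move=> t _; have [] := is_derive_push a t.
  + apply: cvg_at_right_filter; exact: cp.
  + apply: cvg_at_left_filter; exact: cp.
- by move=> t _; rewrite derive1E; have [] := is_derive_push a t.
Qed.

Lemma admissible_push g dg a (b : 'rV[R]_d) : admissible g dg ->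
  (forall i, 0 <= b 0 i) ->
  admissible (fun t => g t + push a t *: b) (fun t => dg t + dpush a t *: b).
Proof.
move=> adm b0.
rewrite (_ : (fun t => dg t + _) = (fun t => 1 *: dg t + dpush a t *: b)).
  apply: (@admissible_reparam_add _ _ id (cst 1)) => //.
  - exact: cst_continuous.
  - exact: is_derive_push.
  - exact: continuous_dpush.
  - exact: dpush_ge0.
by apply/funext => t; rewrite scale1r.
Qed.

End Modify.

Lemma filter_forall_fin {T : Type} (F : set_system T) {FF : Filter F} (I : finType)
  (P : I -> T -> Prop) : (forall i, F (P i)) -> F (fun x => forall i, P i x).
Proof.
move=> H.
have K (s : seq I) : F (fun x => forall i, i \in s -> P i x).
  elim: s => [|i s IH]; first exact: filterE.
  move: (H i) IH; apply: filterS2 => x Pi Ps j.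
  by rewrite inE => /predU1P[->//|]; exact: Ps.
by move: (K (enum I)); apply: filterS => x Px i; apply: Px; rewrite mem_enum.
Qed.

(** * The action *)

Section Cost.
Context {R : realType} {d : nat}.
Implicit Types (g dg : R -> 'rV[R]_d) (t s a b : R).

Definition cost (f : 'rV[R]_d -> R) g dg t : R :=
  powR (f (g t)) (d%:R^-1) * powR (\prod_(i < d) dg t 0 i) (d%:R^-1).

Definition action f g dg a b : R :=
  \int[lebesgue_measure]_(t in `[a, b]) cost f g dg t.

Lemma JfunE f g dg : Jfun f g dg = action f g dg 0 1.
Proof. by []. Qed.

Lemma cost_ge0 f g dg t : 0 <= cost f g dg t.
Proof. by rewrite mulr_ge0 ?powR_ge0. Qed.

Lemma eq_action f g dg h dh a b :
  (forall t, a <= t <= b -> h t = g t /\ dh t = dg t) ->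
  action f h dh a b = action f g dg a b.
Proof.
move=> H; apply: eq_Rintegral => t; rewrite inE /= in_itv /= => /H[].
by rewrite /cost => -> ->.
Qed.

Lemma action_ge0 f g dg a b : 0 <= action f g dg a b.
Proof. by apply: Rintegral_ge0 => t _; exact: cost_ge0. Qed.

(** The sets whose preimage under [g] is measurable within [D] form a sigma-algebra containing the
    open sets. *)
Lemma measurable_borel_comp f g (D : set R) : measurable D ->
  {within D, continuous g} -> borel_fun f -> measurable_fun D (f \o g).
Proof.
move=> mD /continuousP cg bf _ B mB.
have {bf}/= bf := bf _ mB.
have H : <<s open >> `<=` [set A : set 'rV[R]_d | measurable (D `&` g @^-1` A)].
  apply: smallest_sub.
    split => /=.
    - by rewrite preimage_set0 setI0.
    - move=> A mA; rewrite setTD preimage_setC -setDE.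
      rewrite (_ : D `\` _ = D `\` (D `&` g @^-1` A)); first exact: measurableD.
      by rewrite setDIr setDv set0U.
    - move=> F mF; rewrite preimage_bigcup setI_bigcupr.
      exact: bigcup_measurable.
  move=> A oA /=; apply: open_measurable_subspace => //; exact: cg.
exact: H bf.
Qed.

Variables (f : 'rV[R]_d -> R) (M : R).
Hypotheses (fM : forall x, f x <= M) (f0 : forall x, 0 <= f x) (bf : borel_fun f).

Lemma C1_continuous g dg : C1_01 g dg -> {within `[0, 1], continuous g}.
Proof.
move=> C; apply/subspace_continuousP => t t01.
have H (i : 'I_d) :=
  proj1 (@subspace_continuousP _ _ _ _) (C1_coord_continuous (i := i) C) t t01.
apply/cvg_ballP => e e0; rewrite near_withinE.
have K : \forall u \near t, forall i : 'I_d,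
    `[0, 1]%classic u -> `|g t 0 i - g u 0 i| < e.
  apply: filter_forall_fin => i.
  by move/cvgrPdist_lt : (H i) => /(_ _ e0); rewrite near_withinE.
apply: filterS K => u K u01; split=> // j i; rewrite ord1; exact: K.
Qed.

Lemma measurable_cost g dg : admissible g dg ->
  measurable_fun (`[0, 1]%classic : set R) (cost f g dg).
Proof.
move=> [C _]; apply: measurable_funM.
  apply: (@measurableT_comp _ _ _ _ _ _ (@powR R ^~ d%:R^-1) _ (f \o g)).
    exact: measurable_powR.
  by apply: measurable_borel_comp => //; exact: C1_continuous C.
apply: (@measurableT_comp _ _ _ _ _ _ (@powR R ^~ d%:R^-1) _
  (fun t => \prod_(i < d) dg t 0 i)); first exact: measurable_powR.
apply: measurable_prod => i _.
apply: subspace_continuous_measurable_fun => //.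
exact: C1_coord_derivative_continuous C.
Qed.

Lemma cost_bounded g dg : admissible g dg ->
  exists2 B, 0 < B & forall t, t \in `[0, 1] -> cost f g dg t <= B.
Proof.
move=> [C adm]; have [B HB] := C1_derivative_bounded C.
have B1 t i : t \in `[0, 1] -> dg t 0 i <= `|B|.
  by move=> t01; apply: le_trans (HB t i t01) (ler_norm _).
exists (powR `|M| (d%:R^-1) * powR (`|B| ^+ d) (d%:R^-1) + 1).
  by rewrite ltr_pwDr // mulr_ge0 ?powR_ge0.
move=> t t01; rewrite -[leLHS]addr0 lerD //.
apply: ler_pM; rewrite ?powR_ge0 //; apply: ge0_ler_powR;
  rewrite ?invr_ge0 ?ler0n ?nnegrE //.
- exact: le_trans (fM _) (ler_norm _).
- by apply: prodr_ge0 => i _; apply: (adm t t01).1.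
- rewrite -[X in _ ^+ X]card_ord -prodr_const; apply: ler_prod => i _.
  by rewrite B1 // (adm t t01).1.
Qed.

Lemma integrable_cost g dg a b : admissible g dg -> 0 <= a -> b <= 1 ->
  lebesgue_measure.-integrable `[a, b] (EFin \o cost f g dg).
Proof.
move=> adm a0 b1.
have sub : (`[a, b] : set R) `<=` `[0, 1] by apply: subset_itv; rewrite bnd_simp.
apply: measurable_bounded_integrable => //.
- by apply: compact_finite_measure; exact: segment_compact.
- exact: measurable_funS (measurable_cost adm).
- have [B B0 HB] := cost_bounded adm.
  exists B; split; first exact: num_real.
  move=> B' BB' t /sub t01 /=; rewrite ger0_norm ?cost_ge0 //.
  exact: le_trans (HB _ t01) (ltW BB').
Qed.

Lemma action_split g dg a b c : admissible g dg -> 0 <= a -> a <= b -> b <= c ->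
  c <= 1 -> action f g dg a c = action f g dg a b + action f g dg b c.
Proof.
move=> adm a0 ab bc c1; apply/eqP; rewrite addrC -subr_eq; apply/eqP.
rewrite /action Rintegral_itvB ?bnd_simp //; last exact: integrable_cost.
rewrite Rintegral_itv_obnd_cbnd //.
apply: integrableS (integrable_cost adm (le_trans a0 ab) c1) => //.
by apply: subset_itvr; rewrite bnd_simp.
Qed.

(** Endpoints are negligible, so only the open interval matters. When it is empty the condition is
    vacuous, which settles crossing times equal to 0 or 1. *)
Lemma action_zero g dg a b : admissible g dg -> 0 <= a -> b <= 1 ->
  (forall t, a < t < b -> cost f g dg t = 0) -> action f g dg a b = 0.
Proof.
move=> adm a0 b1 H; rewrite /action.
have I := integrable_cost adm a0 b1.
have sub1 : ([set` `]a, b]] : set R) `<=` `[a, b].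
  by apply: subset_itvr; rewrite bnd_simp.
have sub2 : ([set` `]a, b[] : set R) `<=` `[a, b].
  by apply: subset_itv; rewrite bnd_simp.
rewrite -Rintegral_itv_obnd_cbnd; last exact: integrableS I.
rewrite -Rintegral_itv_bndo_bndc; last exact: integrableS I.
rewrite (@eq_Rintegral _ _ _ _ _ (cst 0)) ?Rintegral_cst ?mul0r // => t.
by rewrite inE /= in_itv /= => /H.
Qed.

Lemma le_action g dg a b (c : R -> R) : admissible g dg -> 0 <= a -> b <= 1 ->
  lebesgue_measure.-integrable `[a, b] (EFin \o c) ->
  (forall t, a <= t <= b -> cost f g dg t <= c t) ->
  action f g dg a b <= \int[lebesgue_measure]_(t in `[a, b]) c t.
Proof.
move=> adm a0 b1 ic H; apply: le_Rintegral => //; first exact: integrable_cost.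
Qed.

Lemma ge_action g dg a b (c : R -> R) : admissible g dg -> 0 <= a -> b <= 1 ->
  lebesgue_measure.-integrable `[a, b] (EFin \o c) ->
  (forall t, a <= t <= b -> c t <= cost f g dg t) ->
  \int[lebesgue_measure]_(t in `[a, b]) c t <= action f g dg a b.
Proof.
move=> adm a0 b1 ic H; apply: le_Rintegral => //; exact: integrable_cost.
Qed.

(** Makes the action over a short final piece negligible when a curve is modified there. *)
Lemma action_small g dg : admissible g dg ->
  exists2 B, 0 < B & forall a b, 0 <= a -> a <= b -> b <= 1 ->
    action f g dg a b <= B * (b - a).
Proof.
move=> adm; have [B B0 HB] := cost_bounded adm.
exists B => // a b a0 ab b1.
have -> : B * (b - a) = \int[lebesgue_measure]_(t in `[a, b]) (cst B t).
  rewrite Rintegral_cst //=; congr (_ * _).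
  by rewrite lebesgue_measure_itv /= lte_fin; case: ltgtP ab => //= <-; rewrite subrr.
apply: le_action => //.
  apply: continuous_compact_integrable; first exact: segment_compact.
  by apply: continuous_subspaceT; exact: cst_continuous.
move=> t /andP[a1 b2]; apply: HB; rewrite in_itv /=; apply/andP; split; lra.
Qed.

End Cost.

(* Keeps the arithmetic tactics from unfolding integrals when comparing atoms. *)
#[global] Opaque action.

(** * AM-GM, integrals of weighted derivatives, and crossing times *)

Section Bounds.
Context {R : realType} {d : nat}.
Implicit Types (g dg : R -> 'rV[R]_d) (t s a b : R).

Lemma geo_mean_le (u : 'I_d -> R) : (0 < d)%N -> (forall i, 0 <= u i) ->
  powR (\prod_i u i) d%:R^-1 <= (\sum_i u i) / d%:R.
Proof.
move=> d0 u0; have d0' : 0 < d%:R :> R by rewrite ltr0n.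
have P0 : 0 <= \prod_i u i by apply: prodr_ge0.
have S0 : 0 <= (\sum_i u i) / d%:R by rewrite divr_ge0 ?sumr_ge0 ?ler0n.
have H : \prod_i u i <= ((\sum_i u i) / d%:R) ^+ d.
  have := @leif_AGM R 'I_d predT u; rewrite card_ord.
  by move=> /(_ (fun i _ => u0 i))[].
have dV : 0 <= d%:R^-1 :> R by rewrite invr_ge0 ltW.
apply: (le_trans (ge0_ler_powR dV _ _ H)); rewrite ?nnegrE ?exprn_ge0 //.
by rewrite -powR_mulrn // -powRrM mulfV ?gt_eqF // powRr1.
Qed.

Lemma sum_integral g dg a b (l : 'I_d -> R) : C1_01 g dg ->
  0 <= a -> a <= b -> b <= 1 ->
  lebesgue_measure.-integrable `[a, b] (EFin \o (fun t => \sum_i l i * dg t 0 i)) /\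
  \int[lebesgue_measure]_(t in `[a, b]) (\sum_i l i * dg t 0 i) =
    \sum_i l i * (g b 0 i - g a 0 i).
Proof.
move=> C a0 ab b1.
have sub : (`[a, b] : set R) `<=` `[0, 1] by apply: subset_itv; rewrite bnd_simp.
have I i : lebesgue_measure.-integrable `[a, b] (EFin \o (fun t => dg t 0 i)).
  apply: continuous_compact_integrable; first exact: segment_compact.
  by apply: (continuous_subspaceW sub); exact: C1_coord_derivative_continuous C.
elim: (index_enum _) => [|i s [IH1 IH2]].
  have -> : (fun t => \sum_(i <- [::]) l i * dg t 0 i) = cst 0.
    by apply/funext => t; rewrite big_nil.
  rewrite big_nil; split; first exact: integrable0.
  by rewrite Rintegral_cst // mul0r.
have Ii : lebesgue_measure.-integrable `[a, b] (EFin \o (fun t => l i * dg t 0 i)).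
  rewrite (_ : EFin \o _ = (fun t => (l i)%:E * (dg t 0%R i)%:E)%E) //.
  by apply: integrableZl; [exact: measurable_itv | exact: I].
have -> : (fun t => \sum_(i <- i :: s) l i * dg t 0 i) =
    (fun t => l i * dg t 0 i + \sum_(i <- s) l i * dg t 0 i).
  by apply/funext => t; rewrite big_cons.
rewrite big_cons; split.
  by apply: (integrableD _ Ii IH1); exact: measurable_itv.
by rewrite RintegralD // RintegralZl // (C1_FTC _ C) // IH2.
Qed.

(** The time [s] is the least of the times at which single coordinates reach their levels [z 0 i],
    found by the intermediate value theorem and clamped to [0, 1]. The value 0 covers a coordinate
    that starts at or above its level, the value 1 one that stays at or below it. *)
Lemma exit_down g dg (z : 'rV[R]_d) (i0 : 'I_d) : admissible g dg ->
  exists s, [/\ 0 <= s <= 1, s = 0 \/ vle (g s) z &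
    s = 1 \/ exists i, z 0 i <= g s 0 i].
Proof.
move=> adm; have [C _] := adm.
have H i : exists s, [/\ 0 <= s <= 1, s = 0 \/ g s 0 i <= z 0 i &
    s = 1 \/ z 0 i <= g s 0 i].
  have [h0|h0] := leP (z 0 i) (g 0 0 i).
    by exists 0; rewrite lexx ler01; split => //; [left | right].
  have [h1|h1] := leP (g 1 0 i) (z 0 i).
    by exists 1; rewrite lexx ler01; split => //; [right | left].
  have [|c] := @IVT _ (fun t => g t 0 i) 0 1 (z 0 i) ler01 (C1_coord_continuous C).
    by rewrite ge_min (ltW h0) le_max (ltW h1) orbT.
  by rewrite in_itv /= => c01 E; exists c; rewrite E; split; [|right|right].
have [S HS] := choice H.
case: (@arg_minP _ _ _ i0 predT S isT) => i _ Hi.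
exists (S i); have [/andP[Si0 Si1] _ Si2] := HS i; split; first by rewrite Si0.
- have [->|s0] := eqVneq (S i) 0; [by left | right=> j].
  have [/andP[Sj0 Sj1] [E|E] _] := HS j.
    by case/eqP: s0; apply/eqP; rewrite eq_le Si0 andbT -E Hi.
  by apply: le_trans E; apply: (admissible_mono j adm); rewrite ?Hi.
- by case: Si2 => E; [left | right; exists i].
Qed.

(** Dual to [exit_down]: the greatest of the coordinate crossing times. *)
Lemma enter_up g dg (z : 'rV[R]_d) (i0 : 'I_d) : admissible g dg ->
  exists s, [/\ 0 <= s <= 1, s = 1 \/ vle z (g s) &
    s = 0 \/ exists i, g s 0 i <= z 0 i].
Proof.
move=> adm; have [C _] := adm.
have H i : exists s, [/\ 0 <= s <= 1, s = 1 \/ z 0 i <= g s 0 i &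
    s = 0 \/ g s 0 i <= z 0 i].
  have [h0|h0] := leP (z 0 i) (g 0 0 i).
    by exists 0; rewrite lexx ler01; split => //; [right | left].
  have [h1|h1] := leP (g 1 0 i) (z 0 i).
    by exists 1; rewrite lexx ler01; split => //; [left | right].
  have [|c] := @IVT _ (fun t => g t 0 i) 0 1 (z 0 i) ler01 (C1_coord_continuous C).
    by rewrite ge_min (ltW h0) le_max (ltW h1) orbT.
  by rewrite in_itv /= => c01 E; exists c; rewrite E; split; [|right|right].
have [S HS] := choice H.
case: (@arg_maxP _ _ _ i0 predT S isT) => i _ Hi.
exists (S i); have [/andP[Si0 Si1] _ Si2] := HS i; split; first by rewrite Si0.
- have [->|s0] := eqVneq (S i) 1; [by left | right=> j].
  have Hj : S j <= S i := Hi j isT.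
  have [/andP[Sj0 Sj1] [E|E] _] := HS j.
    by case/eqP: s0; apply/eqP; rewrite eq_le Si1 -E Hj.
  by apply: le_trans E _; apply: (admissible_mono j adm); rewrite ?Hj.
- by case: Si2 => E; [left | right; exists i].
Qed.

End Bounds.

(** * The value function *)

Section ValueBounds.
Context {R : realType} {d : nat}.
Implicit Types (g dg : R -> 'rV[R]_d) (t s a b : R).
Variables (f : 'rV[R]_d -> R) (M : R).
Hypotheses (d_gt0 : (0 < d)%N) (fM : forall x, f x <= M)
  (f0 : forall x, 0 <= f x) (bf : borel_fun f).
Hypothesis supp : forall x, f x != 0 -> vle 0 x /\ vle x (const_mx 1).
Let i0 : 'I_d := Ordinal d_gt0.

Let dV_gt0 : 0 < d%:R^-1 :> R. Proof. by rewrite invr_gt0 ltr0n. Qed.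

(** A monotone coordinate with equal values at [s] and [t] is constant in between, so its derivative
    at [t] vanishes, and with it the product. *)
Lemma cost_zero_const g dg s t i : admissible g dg -> 0 <= s <= 1 -> 0 <= t <= 1 ->
  s != t -> g s 0 i = g t 0 i -> cost f g dg t = 0.
Proof.
move=> adm s01 t01 st E; rewrite /cost (bigD1 i) //=.
rewrite (@C1_coord_const_derivative _ _ g dg s t i) ?in_itv //; last 2 first.
- exact: adm.1.
- move: s01 t01 => /andP[s0 s1] /andP[t0 t1] u.
  have mono x y := @admissible_mono _ _ g dg x y i adm.
  case: (ltP s t) => h /andP[h1 h2]; apply/eqP; rewrite eq_le; apply/andP; split.
  + by apply: mono => //; exact: le_trans h1.
  + by rewrite -E; apply: mono => //; exact: le_trans t1.
  + by rewrite -E; apply: mono => //; exact: le_trans h1.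
  + by apply: mono => //; exact: le_trans s1.
by rewrite mul0r powR0 ?mulr0 // gt_eqF.
Qed.

Lemma cost_zero_f g dg t : f (g t) = 0 -> cost f g dg t = 0.
Proof. by move=> E; rewrite /cost E powR0 ?mul0r // gt_eqF. Qed.

(** If [f (g t)] is nonzero, coordinate [i] is at least 0 at [t] and at most 0 at [s], hence
    constant from [t] to [s]. So motion along the boundary of the orthant costs nothing either. *)
Lemma cost_zero_before g dg s t i : admissible g dg -> s <= 1 ->
  g s 0 i <= 0 -> 0 <= t < s -> cost f g dg t = 0.
Proof.
move=> adm s1 gs /andP[t0 ts].
have [|/supp[/(_ i) + _]] := eqVneq (f (g t)) 0; first exact: cost_zero_f.
rewrite mxE => gt; have := admissible_mono i adm t0 (ltW ts) s1 => gts.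
apply: (cost_zero_const (s := s) (i := i)) => //.
- by rewrite s1 (le_trans t0 (ltW ts)).
- by rewrite t0 (le_trans (ltW ts)).
- by rewrite gt_eqF.
- by apply/eqP; rewrite eq_le gts andbT (le_trans gs).
Qed.

(** Symmetric to [cost_zero_before]: on the support, coordinate [i] cannot exceed the level it has
    already reached at [s]. *)
Lemma cost_zero_after (z : 'rV[R]_d) g dg s t i :
  (forall x, f x != 0 -> vle x z) -> admissible g dg -> 0 <= s ->
  z 0 i <= g s 0 i -> s < t <= 1 -> cost f g dg t = 0.
Proof.
move=> suppz adm s0 gs /andP[st t1].
have [|/suppz/(_ i) gt] := eqVneq (f (g t)) 0; first exact: cost_zero_f.
have := admissible_mono i adm s0 (ltW st) t1 => gts.
apply: (cost_zero_const (s := s) (i := i)) => //.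
- by rewrite s0 (le_trans (ltW st)).
- by rewrite t1 (le_trans s0 (ltW st)).
- by rewrite lt_eqF.
- by apply/eqP; rewrite eq_le gts (le_trans gt).
Qed.

(** Integrating the weighted AM-GM inequality turns derivatives into displacements. Only a bound on
    [f] along this piece is required, which keeps the estimate local. *)
Lemma action_le_weights (l : 'I_d -> R) N g dg a b : admissible g dg ->
  0 <= a -> a <= b -> b <= 1 -> (forall i, 0 < l i) ->
  (forall t, a <= t <= b -> f (g t) <= N) ->
  action f g dg a b <= powR N d%:R^-1 / powR (\prod_i l i) d%:R^-1 / d%:R
     * \sum_i l i * (g b 0 i - g a 0 i).
Proof.
move=> adm a0 ab b1 l0 fN.
have d0 : 0 < d%:R :> R by rewrite ltr0n.
have N0 : 0 <= N by apply: le_trans (fN a _); rewrite ?lexx.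
have [IS <-] := sum_integral l adm.1 a0 ab b1.
set K := powR N d%:R^-1 / _ / _.
have L0 : 0 < powR (\prod_i l i) d%:R^-1 by apply: powR_gt0; apply: prodr_gt0.
have K0 : 0 <= K by rewrite /K !divr_ge0 ?powR_ge0 ?ltW.
rewrite -RintegralZl //; apply: le_action => //.
  rewrite (_ : EFin \o _ = (fun t => K%:E *
    (EFin \o (fun t => \sum_i l i * dg t (0%R : 'I_1) i)%R) t)%E) //.
  by apply: integrableZl => //; exact: measurable_itv.
move=> t /[dup] tab /andP[ta tb]; rewrite /cost.
have dg0 i : 0 <= dg t 0 i.
  by apply: (adm.2 t _).1; rewrite in_itv /= (le_trans a0) // (le_trans tb).
have H : powR (\prod_i l i) d%:R^-1 * powR (\prod_i dg t 0 i) d%:R^-1 <=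
    (\sum_i l i * dg t 0 i) / d%:R.
  rewrite -powRM; [|by apply: prodr_ge0 => i _; exact: ltW|exact: prodr_ge0].
  rewrite -big_split /=; apply: geo_mean_le => // i; exact: mulr_ge0 (ltW _) _.
apply: le_trans (_ : powR N d%:R^-1 * powR (\prod_i dg t 0 i) d%:R^-1 <= _).
  by rewrite ler_wpM2r ?powR_ge0 // ge0_ler_powR ?nnegrE ?(ltW dV_gt0) ?fN.
rewrite /K -!mulrA ler_wpM2l ?powR_ge0 // ler_pdivlMl // [X in _ <= X]mulrC.
exact: H.
Qed.

(** Action accrues only inside the unit cube, where no coordinate moves by more than 1. Hence [L i]
    may be either a number at least 1 or a bound on the actual displacement. *)
Lemma tail_bound (l L : 'I_d -> R) g dg s : admissible g dg -> 0 <= s <= 1 ->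
  (forall i, 0 < l i) -> (forall i, 0 <= L i) ->
  (forall i, 1 <= L i \/ g 1 0 i - g s 0 i <= L i) ->
  action f g dg s 1 <= powR M d%:R^-1 / powR (\prod_i l i) d%:R^-1 / d%:R
     * \sum_i l i * L i.
Proof.
move=> adm /andP[s0 s1] l0 L0 HL.
have [s2 [/andP[s20 s21] up1 up2]] := enter_up 0 i0 adm.
have [b [/andP[b0 b1] dn1 dn2]] := exit_down (const_mx 1) i0 adm.
have C0 : 0 <= powR M d%:R^-1 / powR (\prod_i l i) d%:R^-1 / d%:R *
    \sum_i l i * L i.
  rewrite mulr_ge0 ?sumr_ge0 ?divr_ge0 ?powR_ge0 // => i _.
  by rewrite mulr_ge0 ?L0 ?(ltW (l0 i)).
(* Only [a, b] contributes: before [s2] some coordinate is at most 0, and after [b] some coordinate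
   is at least 1. *)
pose a := Num.max s s2.
have sa : s <= a by rewrite le_max lexx.
have s2a : s2 <= a by rewrite le_max lexx orbT.
have a1 : a <= 1 by rewrite ge_max s1.
have a0 : 0 <= a := le_trans s0 sa.
have Z1 t : s < t < a -> cost f g dg t = 0.
  rewrite lt_max => /andP[st /orP[/(lt_trans st)|ts]]; first by rewrite ltxx.
  have t0 : 0 <= t := le_trans s0 (ltW st).
  case: up2 => [E|[i]]; first by move: ts; rewrite E ltNge t0.
  rewrite mxE => gi; apply: (cost_zero_before (s := s2) (i := i)) => //.
  by rewrite t0.
have Z2 t : b < t < 1 -> cost f g dg t = 0.
  move=> /andP[bt t1].
  case: dn2 => [E|[i gi]]; first by move: bt; rewrite E ltNge (ltW t1).
  apply: (cost_zero_after (fun x Hx => (supp Hx).2) (s := b) adm b0 gi).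
  by rewrite bt ltW.
have A1 := action_zero fM f0 bf adm s0 a1 Z1.
rewrite (action_split fM f0 bf adm s0 sa a1) // A1 add0r.
have [ba|ab] := leP b a.
  rewrite (action_zero fM f0 bf adm a0 (lexx 1)) // => t /andP[a_t t1].
  by apply: Z2; rewrite t1 (le_lt_trans ba).
rewrite (action_split fM f0 bf adm a0 (ltW ab) b1) //.
rewrite (action_zero fM f0 bf adm b0 (lexx 1) Z2) addr0.
have ga : vle 0 (g a).
  move=> i; case: up1 => [E|/(_ i) h].
    by move: ab; rewrite /a E ltNge le_max b1 orbT.
  by apply: le_trans h _; exact: (admissible_mono i adm).
have gb : vle (g b) (const_mx 1).
  by case: dn1 => // E; move: ab; rewrite E ltNge a0.
apply: le_trans (action_le_weights (N := M) adm a0 (ltW ab) b1 l0 (fun t _ => fM _)) _.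
rewrite ler_wpM2l ?divr_ge0 ?powR_ge0 //; apply: ler_sum => i _.
rewrite ler_wpM2l ?(ltW (l0 i)) //; have := ga i; have := gb i; rewrite !mxE => g1 g2.
case: (HL i) => HLi; first by apply: le_trans HLi; lra.
apply: le_trans HLi; rewrite lerB //; exact: (admissible_mono i adm).
Qed.

Lemma ltrB_half (u e x y z : R) : u - e / 2 < x + y -> y <= e / 2 -> 0 <= z ->
  u - e < x + z.
Proof. lra. Qed.

Lemma near_left (B e s : R) : 0 < B -> 0 < e -> 0 < s ->
  exists a, [/\ 0 <= a, a < s & B * (s - a) <= e].
Proof.
move=> B0 e0 s0; exists (Num.max 0 (s - e / B)); split.
- by rewrite le_max lexx.
- by rewrite gt_max s0 ltrBlDr ltrDl divr_gt0.
- rewrite mulrC -ler_pdivlMr // lerBlDr -lerBlDl.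
  by rewrite le_max lexx orbT.
Qed.

(** [tail_bound] with unit weights bounds all actions; a straight line ending at [x] shows that
    there is at least one. *)
Lemma Uext_fin_num x : Uext f x \is a fin_num.
Proof.
have ub : (Uext f x <= (powR M d%:R^-1 / powR (\prod_(i < d) 1) d%:R^-1 / d%:R *
    \sum_(i < d) 1 * 1)%:E)%E.
  apply: ge_ereal_sup => _ [g [dg [adm gx ->]]]; rewrite lee_fin JfunE.
  apply: (tail_bound adm) => //; [by rewrite lexx ler01|by left].
have lb : (0 <= Uext f x)%E.
  have adm1 : admissible (fun t => x + (t - 1) *: const_mx 1)
      (fun=> const_mx 1 : 'rV[R]_d).
    split; [split|].
    - by apply: continuous_subspaceT; exact: cst_continuous.
    - move=> t _; apply: cvg_near_cst; rewrite near_withinE; near=> h => _.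
      have h0 : h != 0 by near: h; exact: nbhs_dnbhs_neq.
      rewrite opprD addrACA subrr add0r -scalerBl.
      have -> : t + h - 1 - (t - 1) = h by lra.
      by rewrite scalerA mulVf // scale1r.
    - move=> t _; split=> [i|]; first by rewrite mxE.
      by apply/eqP => /rowP/(_ i0)/eqP; rewrite !mxE oner_eq0.
  apply: le_trans (ereal_sup_ubound _); last first.
    eexists; eexists; split; [exact: adm1 | | reflexivity] => i.
    by rewrite /= subrr scale0r addr0.
  by rewrite lee_fin JfunE action_ge0.
by rewrite fin_numE; apply/andP; split; apply: contraTneq ub => // E; rewrite E in lb *.
Unshelve. all: by end_near. Qed.

Lemma action_le_U g dg x : admissible g dg -> vle (g 1) x -> action f g dg 0 1 <= U f x.
Proof.
move=> adm gx; rewrite -lee_fin /U (fineK (Uext_fin_num x)).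
by apply: ereal_sup_ubound; exists g, dg.
Qed.

Lemma U_adherent x e : 0 < e ->
  exists g dg, [/\ admissible g dg, vle (g 1) x & U f x - e < action f g dg 0 1].
Proof.
move=> e0; have [_ [g [dg [adm gx ->]]] H] := ub_ereal_sup_adherent e0 (Uext_fin_num x).
exists g, dg; split=> //; rewrite -lte_fin EFinB /U (fineK (Uext_fin_num x)).
rewrite -JfunE; exact H.
Qed.

Lemma pareto_monotone_U : pareto_monotone (U f).
Proof.
move=> x y xy; apply/ler_addgt0Pr => e /(U_adherent x)[g [dg [adm gx H]]].
have := action_le_U adm (fun i => le_trans (gx i) (xy i)); lra.
Qed.

Lemma U_ge0 x : 0 <= U f x.
Proof.
have [g [dg [adm gx _]]] := U_adherent x ltr01.
exact: le_trans (action_ge0 _ _ _ _ _) (action_le_U adm gx).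
Qed.

(** Braking from a time [a] slightly before [s] gives a full curve ending below [g s]. Its action is
    at least that of [g] on [0, a], and the loss on [a, s] is at most [e]. *)
Lemma action_truncate_le_U g dg s x : admissible g dg -> 0 <= s <= 1 ->
  vle (g s) x -> action f g dg 0 s <= U f x.
Proof.
move=> adm /andP[s0 s1] gx.
move: s0; rewrite le_eqVlt => /predU1P[<-|s0].
  rewrite (action_zero fM f0 bf adm) ?U_ge0 // => t /andP[/lt_trans h /h].
  by rewrite ltxx.
have [B B0 HB] := action_small fM f0 bf adm.
apply/ler_addgt0Pr => e e0.
have [a [a0 as_ aB]] : exists a, [/\ 0 <= a, a < s & B * (s - a) <= e].
  by exact: near_left.
have [g2 [dg2 [adm2 g21 H]]] := admissible_brake adm a0 as_ s1.
have E : action f g2 dg2 0 a = action f g dg 0 a.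
  by apply: eq_action => t /andP[_ ta]; exact: H.
have J2 : action f g2 dg2 0 1 <= U f x.
  by apply: (action_le_U adm2) => i; exact: le_trans (g21 i) (gx i).
have a1 : a <= 1 := le_trans (ltW as_) s1.
have S1 := action_split fM f0 bf adm (lexx 0) a0 (ltW as_) s1.
have S2 := action_split fM f0 bf adm2 (lexx 0) a0 a1 (lexx 1).
have T := action_ge0 f g2 dg2 a 1.
have T2 := le_trans (HB _ _ a0 (ltW as_) s1) aB.
rewrite S1 -E; apply: le_trans (lerD (lexx _) T2) _; rewrite lerD2r.
by apply: le_trans J2; rewrite S2 lerDl.
Qed.

(** A push by [x - g 1] in a short final time moves the endpoint to [x] exactly, at a loss of at
    most [e / 2]. *)
Lemma U_adherent_endpoint x e : 0 < e ->
  exists g dg, [/\ admissible g dg, g 1 = x & U f x - e < action f g dg 0 1].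
Proof.
move=> e0; have e20 : 0 < e / 2 by lra.
have [g [dg [adm gx H]]] := U_adherent x e20.
have [B B0 HB] := action_small fM f0 bf adm.
have [a [a0 a1 aB]] : exists a, [/\ 0 <= a, a < 1 & B * (1 - a) <= e / 2].
  by apply: near_left => //; exact: ltr01.
have adm2 := admissible_push a (b := x - g 1) adm.
have b0 i : 0 <= (x - g 1) 0 i by rewrite !mxE subr_ge0.
move/(_ b0) in adm2.
set g2 := (X in admissible X _) in adm2; set dg2 := (X in admissible _ X) in adm2.
exists g2, dg2; split; first exact: adm2.
  by rewrite /g2 push1 // scale1r addrC subrK.
have E : action f g2 dg2 0 a = action f g dg 0 a.
  apply: eq_action => t /andP[_ ta].
  by rewrite /g2 /dg2 push_le // /dpush max_r ?subr_le0 // mulr0 !scale0r !addr0.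
have S1 := action_split fM f0 bf adm (lexx 0) a0 (ltW a1) (lexx 1).
have S2 := action_split fM f0 bf adm2 (lexx 0) a0 (ltW a1) (lexx 1).
have T := action_ge0 f g2 dg2 a 1.
have T2 := le_trans (HB _ _ a0 (ltW a1) (lexx 1)) aB.
rewrite S2 E; rewrite S1 in H.
exact: ltrB_half H T2 T.
Qed.

End ValueBounds.

(** * Truncation at the support, vanishing off the orthant, continuity *)

Section Value.
Context {R : realType} {d : nat}.
Implicit Types (g dg : R -> 'rV[R]_d) (t s a b : R).
Variables (f : 'rV[R]_d -> R) (M : R).
Hypotheses (d_gt0 : (0 < d)%N) (fM : forall x, f x <= M)
  (f0 : forall x, 0 <= f x) (bf : borel_fun f).
Hypothesis supp : forall x, f x != 0 -> vle 0 x /\ vle x (const_mx 1).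
Let i0 : 'I_d := Ordinal d_gt0.

Let mono := @pareto_monotone_U R d f M d_gt0 fM f0 bf supp.
Let adherent x (e : R) := @U_adherent R d f M d_gt0 fM f0 bf supp x e.
Let trunc := @action_truncate_le_U R d f M d_gt0 fM f0 bf supp.
Let nonneg := @U_ge0 R d f M d_gt0 fM f0 bf supp.

(** Once a coordinate has reached its level in [z] the cost vanishes, so a nearly optimal curve may
    be cut there. *)
Lemma U_vmin (z x : 'rV[R]_d) : (forall y, f y != 0 -> vle y z) ->
  U f x = U f (vmin x z).
Proof.
move=> suppz; apply/eqP; rewrite eq_le; apply/andP; split; last first.
  by apply: mono => i; rewrite mxE ge_min lexx.
apply/ler_addgt0Pr => e /(adherent x)[g [dg [adm gx H]]].
suff : action f g dg 0 1 <= U f (vmin x z).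
  by rewrite -lerBlDr; apply: le_trans; exact: ltW.
have [s [/[dup] s01 /andP[s0 s1] dn1 dn2]] := exit_down z i0 adm.
have Z : action f g dg s 1 = 0.
  apply: (action_zero fM f0 bf adm s0 (lexx 1)) => t /andP[st t1].
  case: dn2 => [E|[i gi]]; first by move: st; rewrite E ltNge (ltW t1).
  by apply: (cost_zero_after d_gt0 suppz adm s0 gi); rewrite st ltW.
rewrite (action_split fM f0 bf adm (lexx 0) s0 s1 (lexx 1)) Z addr0.
case: dn1 => [->|gz].
  rewrite (action_zero fM f0 bf adm (lexx 0) ler01); first exact: nonneg.
  by move=> t /andP[/lt_trans h /h]; rewrite ltxx.
apply: (trunc adm s01) => i; rewrite mxE le_min gz andbT.
by apply: le_trans (gx i); exact: (admissible_mono i adm).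
Qed.

Lemma U_out_posorthant x : ~ posorthant x -> U f x = 0.
Proof.
move=> /existsNP[i /negP]; rewrite -leNgt => xi.
apply/eqP; rewrite eq_le nonneg andbT.
apply/ler_addgt0Pr => e /(adherent x)[g [dg [adm gx H]]].
move: H; rewrite (action_zero fM f0 bf adm (lexx 0) (lexx 1)); last first.
  move=> t /andP[t0 t1].
  apply: (cost_zero_before d_gt0 supp (s := 1) (i := i) adm) => //.
    exact: le_trans (gx i) xi.
  by rewrite (ltW t0).
by rewrite subr_lt0 add0r => /ltW.
Qed.

(** A nearly optimal curve is cut where it leaves the set below [x]. The initial piece is bounded by
    [U f x]; during the rest some coordinate [j] moves by at most [h]. *)
Lemma U_shift x (h l : R) : 0 <= h -> 0 < l ->
  U f (x + const_mx h) <=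
    U f x + powR M d%:R^-1 / d%:R * (l ^+ d.-1 * h + d%:R / l).
Proof.
move=> h0 l0; set C := powR M _ / _ * _.
have C0 : 0 <= C.
  rewrite /C mulr_ge0 ?divr_ge0 ?powR_ge0 ?ler0n ?addr_ge0 //.
  - by rewrite mulr_ge0 // exprn_ge0 // ltW.
  - by rewrite divr_ge0 ?ler0n // ltW.
apply/ler_addgt0Pr => e /(adherent (x + const_mx h))[g [dg [adm gx H]]].
suff : action f g dg 0 1 <= U f x + C.
  by move=> HJ; rewrite -lerBlDr; exact: le_trans (ltW H) HJ.
have [s [/[dup] s01 /andP[s0 s1] dn1 dn2]] := exit_down x i0 adm.
rewrite (action_split fM f0 bf adm (lexx 0) s0 s1 (lexx 1)); apply: lerD.
  case: dn1 => [->|gz].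
    rewrite (action_zero fM f0 bf adm (lexx 0) ler01); first exact: nonneg.
    by move=> t /andP[/lt_trans k /k]; rewrite ltxx.
  exact: (trunc adm s01).
case: dn2 => [->|[j gj]].
  rewrite (action_zero fM f0 bf adm ler01 (lexx 1)) //.
  by move=> t /andP[/lt_trans k /k]; rewrite ltxx.
(* The slow coordinate gets the large weight; the weights multiply to 1, so the other coordinates
   contribute only a multiple of [1 / l]. *)
pose w i := if i == j then l ^+ d.-1 else l^-1.
pose L i := if i == j then h else 1.
have w0 i : 0 < w i by rewrite /w; case: ifP => _; rewrite ?exprn_gt0 ?invr_gt0.
have L0 i : 0 <= L i by rewrite /L; case: ifP.
have w1 : \prod_i w i = 1.
  rewrite (bigD1 j) //= {1}/w eqxx (eq_bigr (fun=> l^-1)) => [|i /negPf ij]; last first.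
    by rewrite /w ij.
  rewrite prodr_const (_ : #|_| = d.-1); last by rewrite cardC1 card_ord.
  by rewrite exprVn mulfV // expf_neq0 // gt_eqF.
have := @tail_bound _ _ f M d_gt0 fM f0 bf supp w L g dg s adm s01 w0 L0.
rewrite w1 powR1 divr1 => /(_ _)K.
apply: le_trans (K _) _ => [i|].
  rewrite /L; case: eqP => [->|_]; [right | by left].
  by rewrite lerBlDl; apply: le_trans (gx j) _; rewrite !mxE lerD2r.
rewrite /C ler_wpM2l ?divr_ge0 ?powR_ge0 ?ler0n //.
rewrite (bigD1 j) //= {1}/w {1}/L eqxx lerD2l.
rewrite (eq_bigr (fun=> l^-1)) => [|i /negPf ij]; last by rewrite /w /L ij mulr1.
rewrite sumr_const -[X in X <= _]mulr_natl ler_wpM2r ?invr_ge0 ?(ltW l0) //.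
by rewrite ler_nat -[leqRHS]card_ord max_card.
Qed.

Lemma continuous_U : continuous (U f).
Proof.
move=> x A /nbhs_ballP[e' /= e'0 HA].
have [e e0 ee'] : exists2 e, 0 < e & e < e' by exists (e' / 2); lra.
pose K := powR M d%:R^-1 / d%:R + 1.
have K0 : 0 < K by rewrite ltr_pwDr // divr_ge0 ?powR_ge0 ?ler0n.
have d0 : 0 < d%:R :> R by rewrite ltr0n.
(* First [l] makes [K * d / l] equal to [e / 2], then [h] does the same for
   [K * l ^ (d - 1) * h]. *)
pose l := 2 * K * d%:R / e.
have l0 : 0 < l by rewrite !mulr_gt0 ?invr_gt0.
pose h := e / (2 * K * l ^+ d.-1).
have ld : 0 < l ^+ d.-1 by rewrite exprn_gt0.
have h0 : 0 < h by rewrite divr_gt0 // !mulr_gt0.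
have Ke : powR M d%:R^-1 / d%:R * (l ^+ d.-1 * h + d%:R / l) <= e.
  have E : K * (l ^+ d.-1 * h + d%:R / l) = e.
    by rewrite /h /l; field; rewrite !gt_eqF.
  rewrite -E ler_wpM2r //.
    by apply: addr_ge0; [apply: mulr_ge0 | apply: divr_ge0]; exact: ltW.
  by rewrite /K lerDl.
have B y : U f (y + const_mx h) <= U f y + e.
  by apply: le_trans (U_shift y (ltW h0) l0) _; rewrite lerD2l.
apply/nbhs_ballP; exists h => // y [_ xy].
have xyi i : x 0 i - h <= y 0 i <= x 0 i + h.
  have := xy 0 i; rewrite /ball /= ltr_norml => /andP[h1 h2].
  by apply/andP; split; lra.
apply: HA; apply: le_lt_trans ee'.
(* Each of [x] and [y] lies below the diagonal shift of the other by [h], so monotonicity and [B]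
   conclude. *)
rewrite ler_norml lerBlDr lerBrDr [- e + _]addrC lerBlDr [e + _]addrC.
apply/andP; split.
  apply: le_trans (B x); apply: mono => i; rewrite !mxE.
  by have /andP[] := xyi i.
apply: le_trans (B y); apply: mono => i; rewrite !mxE.
by have /andP[] := xyi i; rewrite lerBlDr.
Qed.

End Value.

(** * Sub- and superdifferentials, semicontinuous envelopes *)

Section Differentials.
Context {R : realType} {d : nat}.
Implicit Types (x y p v : 'rV[R]_d) (u : 'rV[R]_d -> R).

Lemma near_box x (P : set 'rV[R]_d) : (\forall y \near x, P y) ->
  exists2 r : R, 0 < r & forall y, (forall i, `|x 0 i - y 0 i| <= r) -> P y.
Proof.
move=> /nbhs_ballP[r /= r0 H]; exists (r / 2); first by rewrite divr_gt0.
move=> y xy; apply: H; split=> // i j; rewrite ord1 /ball /=.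
by apply: le_lt_trans (xy j) _; lra.
Qed.

Lemma enorm_le v (r : R) : 0 <= r -> (forall i, `|v 0 i| <= r) -> enorm v <= d%:R * r.
Proof.
move=> r0 vr; rewrite /enorm /dotv.
have dr0 : 0 <= d%:R * r by rewrite mulr_ge0.
rewrite -[leRHS]ger0_norm // -sqrtr_sqr ler_sqrt ?sqr_ge0 //.
apply: (@le_trans _ _ (d%:R * r ^+ 2)).
  rewrite -[d in leRHS]card_ord mulr_natl -sumr_const; apply: ler_sum => i _.
  by rewrite -expr2 -real_normK ?num_real // lerXn2r ?nnegrE.
case: (posnP d) => [->|d0]; first by rewrite !mul0r expr0n.
rewrite exprMn ler_wpM2r ?sqr_ge0 // expr2 ler_peMr // ler1n //.
Qed.

Lemma enorm_delta (i : 'I_d) (c : R) : enorm (c *: delta_mx 0 i) = `|c|.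
Proof.
rewrite /enorm /dotv (bigD1 i) //= big1 => [|j /negPf ji].
  by rewrite !mxE !eqxx mulr1 addr0 -expr2 sqrtr_sqr.
by rewrite !mxE eqxx ji /= mulr0 mul0r.
Qed.

Lemma dotv_delta p (i : 'I_d) (c : R) : dotv p (c *: delta_mx 0 i) = c * p 0 i.
Proof.
rewrite /dotv (bigD1 i) //= big1 => [|j /negPf ji].
  by rewrite !mxE !eqxx mulr1 addr0 mulrC.
by rewrite !mxE eqxx ji /= !mulr0.
Qed.

Lemma delta_small (i j : 'I_d) x (c r : R) : `|c| <= r ->
  `|x 0 j - (x + c *: delta_mx 0 i) 0 j| <= r.
Proof.
move=> cr; rewrite !mxE opprD addrA subrr sub0r normrN eqxx /=.
by case: eqP => _; rewrite ?mulr1 // mulr0 normr0 (le_trans _ cr).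
Qed.

(** Tested at [x + r e_i], where [u] is at least [u x]. *)
Lemma superdiff_ge0 u x p i : pareto_monotone u -> superdiff u x p -> 0 <= p 0 i.
Proof.
move=> mono H; apply/ler_addgt0Pr => e /H/near_box[r r0 K].
have /K : forall j, `|x 0 j - (x + r *: delta_mx 0 i) 0 j| <= r.
  by move=> j; apply: delta_small; rewrite gtr0_norm.
rewrite [_ + _ - x]addrAC subrr add0r enorm_delta dotv_delta gtr0_norm // => L.
have : u x <= u (x + r *: delta_mx 0 i).
  apply: mono => j; rewrite !mxE lerDl.
  by apply: mulr_ge0; rewrite ?ler0n // ltW.
move: (u x) (u _) L => u1 u2 L u12; rewrite -(pmulr_rge0 _ r0); lra.
Qed.

(** Tested at [x - r e_i], where [u] is at most [u x]. *)
Lemma subdiff_ge0 u x p i : pareto_monotone u -> subdiff u x p -> 0 <= p 0 i.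
Proof.
move=> mono H; apply/ler_addgt0Pr => e /H/near_box[r r0 K].
have /K : forall j, `|x 0 j - (x + (- r) *: delta_mx 0 i) 0 j| <= r.
  by move=> j; apply: delta_small; rewrite normrN gtr0_norm.
rewrite [_ + _ - x]addrAC subrr add0r enorm_delta dotv_delta normrN gtr0_norm // => L.
have : u (x + (- r) *: delta_mx 0 i) <= u x.
  apply: mono => j; rewrite !mxE mulNr gerDl oppr_le0.
  by apply: mulr_ge0; rewrite ?ler0n // ltW.
move: (u x) (u _) L => u1 u2 L u12; rewrite -(pmulr_rge0 _ r0); lra.
Qed.

(** A nearly minimal radius in the infimum does it; dividing by [d] fits a box into the Euclidean
    ball. The bound [G] ensures that the suprema and the infimum are genuine. *)
Lemma usc_env_lt (w : 'rV[R]_d -> R) (G : R) x c : (0 < d)%N ->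
  (forall y, `|w y| <= G) -> usc_env w x < c ->
  exists r K, [/\ 0 < r, K < c &
    forall y, (forall i, `|x 0 i - y 0 i| <= r) -> w y <= K].
Proof.
move=> d0 wG; rewrite /usc_env; set S := (X in inf X) => Sc.
have d0' : 0 < d%:R :> R by rewrite ltr0n.
have ub r : has_ubound [set w y | y in [set y | enorm (x - y) <= r]].
  by exists G => _ [y _ <-]; exact: le_trans (ler_norm _) (wG y).
have xin (r : R) : 0 < r -> [set y | enorm (x - y) <= r] x.
  move=> r0; rewrite /= subrr; apply: le_trans (@enorm_le 0 0 _ _) _ => //.
    by move=> i; rewrite mxE normr0.
  by rewrite mulr0 ltW.
have hS : has_inf S.
  split; first by exists (sup [set w y | y in [set y | enorm (x - y) <= 1]]), 1 => //=.
  exists (- G) => _ [r r0 <-]; apply: (@le_trans _ _ (w x)).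
    by rewrite lerNl; apply: le_trans (wG x); rewrite -normrN ler_norm.
  by apply: ub_le_sup => //; exists x => //; exact: xin.
have e0 : 0 < c - inf S by rewrite subr_gt0.
have [_ [r r0 <-] rc] := inf_adherent e0 hS.
rewrite addrC subrK in rc.
exists (r / d%:R), (sup [set w y | y in [set y | enorm (x - y) <= r]]); split => //.
  exact: divr_gt0.
move=> y xy; apply: ub_le_sup => //; exists y => //=.
have rd0 : 0 <= r / d%:R by rewrite divr_ge0 // ltW.
apply: le_trans (enorm_le rd0 _) _ => [i|]; first by rewrite !mxE.
by rewrite mulrC divfK // gt_eqF.
Qed.

End Differentials.

(** * Viscosity inequalities *)

Lemma dpp_arith (R : realType) (u w e k A B C : R) : B <= e / 2 -> k <= C ->
  u - e / 2 <= A + B -> A + C <= w -> u + k <= w + e.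
Proof. lra. Qed.

Lemma geo_mean_scale_le (R : realType) (d : nat) (c : R) (v w : 'I_d -> R) :
  (0 < d)%N -> 0 <= c -> (forall i, 0 <= v i) -> (forall i, c * v i <= w i) ->
  c * powR (\prod_i v i) d%:R^-1 <= powR (\prod_i w i) d%:R^-1.
Proof.
move=> d0 c0 v0 cvw; have dV0 : 0 <= d%:R^-1 :> R by rewrite invr_ge0.
have P0 : 0 <= \prod_i v i by apply: prodr_ge0.
have cd0 : 0 <= c ^+ d by rewrite exprn_ge0.
have cE : c = powR (c ^+ d) d%:R^-1.
  by rewrite -powR_mulrn // -powRrM mulfV ?powRr1 // gt_eqF // ltr0n.
have cv0 i : 0 <= c * v i by rewrite mulr_ge0.
rewrite [X in X * _]cE -powRM //; apply: ge0_ler_powR; rewrite ?nnegrE ?mulr_ge0 //.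
  by apply: prodr_ge0 => i _; apply: le_trans (cvw i).
rewrite -[X in _ ^+ X]card_ord -prodr_const -big_split /=.
by apply: ler_prod => i _; rewrite cv0 cvw.
Qed.

(** * Dynamic programming inequalities on small boxes *)

Section DynamicProgramming.
Context {R : realType} {d : nat}.
Implicit Types (g dg : R -> 'rV[R]_d) (t s a b : R) (x y p v : 'rV[R]_d).
Variables (f : 'rV[R]_d -> R) (M : R).
Hypotheses (d_gt0 : (0 < d)%N) (fM : forall x, f x <= M)
  (f0 : forall x, 0 <= f x) (bf : borel_fun f).
Hypothesis supp : forall x, f x != 0 -> vle 0 x /\ vle x (const_mx 1).
Let i0 : 'I_d := Ordinal d_gt0.

Let mono := @pareto_monotone_U R d f M d_gt0 fM f0 bf supp.
Let adherent x (e : R) := @U_adherent R d f M d_gt0 fM f0 bf supp x e.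
Let adherent1 x (e : R) := @U_adherent_endpoint R d f M d_gt0 fM f0 bf supp x e.
Let trunc := @action_truncate_le_U R d f M d_gt0 fM f0 bf supp.
Let nonneg := @U_ge0 R d f M d_gt0 fM f0 bf supp.
Let leU := @action_le_U R d f M d_gt0 fM f0 bf supp.

Let dV_gt0 : 0 < d%:R^-1 :> R. Proof. by rewrite invr_gt0 ltr0n. Qed.

(* Leaving the box [x - h, x] along a nearly optimal curve. *)
Lemma dpp_upper x (p : 'I_d -> R) (h N e : R) : (forall i, 0 < p i) -> 0 < h -> 0 < e ->
  (forall y, (forall i, x 0 i - h <= y 0 i <= x 0 i) -> f y <= N) ->
  exists y, [/\ forall i, x 0 i - h <= y 0 i <= x 0 i, exists i, y 0 i <= x 0 i - h &
    U f x <= e + (U f y + powR N d%:R^-1 / powR (\prod_i p i) d%:R^-1 / d%:R *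
       \sum_i p i * (x 0 i - y 0 i))].
Proof.
move=> p0 h0 /(adherent x)[g [dg [adm gx /ltW H]]] fN; set C := powR N _ / _ / _.
have C0 : 0 <= C by rewrite /C !divr_ge0 ?powR_ge0.
suff [y [y1 y2 Hy]] : exists y, [/\ forall i, x 0 i - h <= y 0 i <= x 0 i,
    exists i, y 0 i <= x 0 i - h &
    action f g dg 0 1 <= U f y + C * \sum_i p i * (x 0 i - y 0 i)].
  by exists y; split => //; rewrite -lerBlDl; exact: le_trans H Hy.
have [s [/[dup] s01 /andP[s0 s1] up1 up2]] := enter_up (x - const_mx h) i0 adm.
have W y a : vle (x - const_mx h) y -> vle y (g a) -> 0 <= a -> a <= 1 ->
    action f g dg a 1 <= C * \sum_i p i * (x 0 i - y 0 i).
  move=> xy ya a0 a1.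
  apply: le_trans (action_le_weights d_gt0 fM f0 bf (N := N) adm a0 a1 (lexx 1) p0 _) _.
    move=> t /andP[a_t t1]; apply: fN => i; apply/andP; split.
      have := xy i; rewrite !mxE => /le_trans; apply; apply: le_trans (ya i) _.
      exact: (admissible_mono i adm).
    apply: le_trans (gx i).
    by apply: (admissible_mono i adm) => //; exact: le_trans a_t.
  rewrite ler_wpM2l //; apply: ler_sum => i _; rewrite ler_wpM2l ?(ltW (p0 i)) //.
  by apply: lerB; [exact: gx | exact: ya].
have xh i : (x - const_mx h) 0 i = x 0 i - h by rewrite !mxE.
have [E|up] : s = 1 \/ vle (x - const_mx h) (g s) by [].
  have [i gi] : exists i, g 1 0 i <= (x - const_mx h) 0 i.
    case: up2 => [E0|]; last by rewrite E.
    by move/eqP: E0; rewrite E oner_eq0.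
  (* A curve that reaches time 1 with coordinate [i] at most [x 0 i - h] ends below this point, so
     [U f y] bounds its whole action. *)
  pose y := \row_j (if j == i then x 0 j - h else x 0 j).
  have y1 j : x 0 j - h <= y 0 j <= x 0 j.
    by rewrite mxE; case: eqP => _; rewrite lexx ?andbT /= gerBl ltW.
  exists y; split => //; first by exists i; rewrite mxE eqxx.
  apply: (@le_trans _ _ (U f y)).
    apply: (leU adm) => j; rewrite mxE; case: eqP => [->|_]; last exact: gx.
    by rewrite -xh.
  rewrite lerDl mulr_ge0 // sumr_ge0 // => j _.
  by rewrite mulr_ge0 ?(ltW (p0 j)) // subr_ge0; have /andP[] := y1 j.
(* A curve above [x - h] from the start is compared with that corner, where [U] is nonnegative. *)
case: up2 => [E|[i gi]].
  exists (x - const_mx h); split.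
  - by move=> i; rewrite xh lexx gerBl ltW.
  - by exists i0; rewrite xh.
  - apply: le_trans (W (x - const_mx h) 0 _ _ (lexx 0) ler01) _ => //.
      by rewrite -E.
    by rewrite lerDr.
exists (g s); split.
- move=> j; rewrite -xh up /=; apply: le_trans (gx j); exact: (admissible_mono j adm).
- by exists i; rewrite -xh.
- rewrite (action_split fM f0 bf adm (lexx 0) s0 s1 (lexx 1)); apply: lerD.
    by apply: (trunc adm s01).
  by apply: W.
Qed.

Lemma integrable_continuous (c : R -> R) a b : continuous c ->
  lebesgue_measure.-integrable `[a, b] (EFin \o c).
Proof.
move=> cc; apply: continuous_compact_integrable; first exact: segment_compact.
exact: continuous_subspaceT.
Qed.

Lemma push_ge0 a t : 0 <= push a t.
Proof. by rewrite /push /halfsq_plus mulr_ge0 // divr_ge0 ?sqr_ge0. Qed.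

(* A nearly optimal curve ending at [x - h v] is pushed to [x] in a short final time. *)
Lemma dpp_lower x v (h N : R) : (forall i, 0 < v 0 i) -> 0 < h -> 0 <= N ->
  (forall y, (forall i, x 0 i - 2 * h * v 0 i <= y 0 i <= x 0 i) -> N <= f y) ->
  U f (x - h *: v) + powR N d%:R^-1 * powR (\prod_i v 0 i) d%:R^-1 * h <= U f x.
Proof.
move=> v0 h0 N0 fN; set k := powR N _ * _.
have k0 : 0 <= k by rewrite mulr_ge0 ?powR_ge0.
apply/ler_addgt0Pr => e e0; have e20 : 0 < e / 2 by rewrite divr_gt0.
have [g [dg [adm g1 /ltW H]]] := adherent1 (x - h *: v) e20.
have [B B0 HB] := action_small fM f0 bf adm.
(* The endpoint [x - h v] is strictly above [x - 2 h v], so the curve is in the larger box from some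
   [s < 1] on. Pushing after [s] keeps it where [f] is at least [N]. *)
have [s [/andP[s0 s1] up1 up2]] := enter_up (x - (2 * h) *: v) i0 adm.
have g1i i : g 1 0 i = x 0 i - h * v 0 i by rewrite g1 !mxE.
have xi i : (x - (2 * h) *: v) 0 i = x 0 i - 2 * h * v 0 i by rewrite !mxE.
have s_lt1 : s < 1.
  rewrite lt_neqAle s1 andbT; apply/eqP => E; case: up2 => [|[i]].
    by rewrite E => /eqP; rewrite oner_eq0.
  by rewrite E g1i xi; have := mulr_gt0 h0 (v0 i); lra.
have {}up1 : vle (x - (2 * h) *: v) (g s).
  by case: up1 => // E; move: s_lt1; rewrite E ltxx.
have [a' [a'0 a'1 aB']] := near_left B0 e20 (ltr01 : 0 < 1 :> R).
have [a [a0 a1 sa aB]] : exists a, [/\ 0 <= a, a < 1, s <= a & B * (1 - a) <= e / 2].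
  exists (Num.max s a'); split.
  - by rewrite le_max s0.
  - by rewrite gt_max s_lt1.
  - by rewrite le_max lexx.
  - apply: le_trans aB'; rewrite ler_pM2l // lerD2l lerN2.
    by rewrite le_max lexx orbT.
have b0 i : 0 <= (h *: v) 0 i by rewrite mxE mulr_ge0 ?ltW.
have adm2 := admissible_push a adm b0.
set g2 := (X in admissible X _) in adm2; set dg2 := (X in admissible _ X) in adm2.
have g21 : g2 1 = x by rewrite /g2 push1 // scale1r g1 subrK.
have E : action f g2 dg2 0 a = action f g dg 0 a.
  apply: eq_action => t /andP[_ ta].
  by rewrite /g2 /dg2 push_le // /dpush max_r ?subr_le0 // mulr0 !scale0r !addr0.
have S1 := action_split fM f0 bf adm (lexx 0) a0 (ltW a1) (lexx 1).
have S2 := action_split fM f0 bf adm2 (lexx 0) a0 (ltW a1) (lexx 1).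
have T2 := le_trans (HB _ _ a0 (ltW a1) (lexx 1)) aB.
(* The push alone provides this action: the new derivative dominates [dpush a t *: (h *: v)], and
   [dpush a] has integral 1. *)
have T : k * h <= action f g2 dg2 a 1.
  have -> : k * h = \int[lebesgue_measure]_(t in `[a, 1]) (k * h * dpush a t).
    rewrite RintegralZl; first by rewrite (dpush_integral a1) mulr1.
      exact: measurable_itv.
    exact: integrable_continuous (@continuous_dpush _ a).
  apply: (ge_action fM f0 bf adm2 a0 (lexx 1)).
    apply: integrable_continuous => t; apply: cvgM; first exact: cvg_cst.
    exact: continuous_dpush.
  move=> t /andP[a_t t1].
  have t0 : 0 <= t := le_trans a0 a_t.
  have fNt : N <= f (g2 t).
    apply: fN => i; apply/andP; split.
      rewrite -xi; apply: le_trans (up1 i) _.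
      apply: le_trans (admissible_mono i adm s0 (le_trans sa a_t) t1) _.
      by rewrite /g2 mxE lerDl mxE mulr_ge0 ?push_ge0.
    rewrite -g21; exact: (admissible_mono i adm2).
  have -> : k * h * dpush a t =
      powR N d%:R^-1 * (h * dpush a t * powR (\prod_i v 0 i) d%:R^-1).
    by rewrite /k; ring.
  apply: ler_pM.
  - exact: powR_ge0.
  - apply: mulr_ge0; last exact: powR_ge0.
    by apply: mulr_ge0; [exact: ltW | exact: dpush_ge0].
  - apply: ge0_ler_powR; rewrite ?nnegrE.
    + exact: ltW.
    + exact: N0.
    + exact: f0.
    + exact: fNt.
  apply: geo_mean_scale_le => [//||i|i].
  - by apply: mulr_ge0; [exact: ltW | exact: dpush_ge0].
  - exact: ltW.
  - rewrite /dg2 !mxE mulrA [dpush a t * h]mulrC lerDr.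
    by apply: (adm.2 t _).1; rewrite in_itv /= t0.
have {}J : action f g2 dg2 0 1 <= U f x by apply: (leU adm2) => i; rewrite g21.
move: H J; rewrite S1 S2 E.
exact: dpp_arith T2 T.
Qed.

End DynamicProgramming.

(** Adding the estimates leaves [(1 - c) * S <= 3 / 4 * (1 - c) * w], against [w <= S]. *)
Lemma sub_arith (R : realType) (c w S u1 u2 : R) : c < 1 -> 0 < w -> w <= S ->
  u1 <= (1 - c) * w / 4 + (u2 + c * S) -> u2 - u1 + S <= (1 - c) * w / 2 -> False.
Proof.
move=> c1 w0 wS H1 H2.
have : (1 - c) * w <= (1 - c) * S by rewrite ler_pM2l // subr_gt0.
have : 0 < (1 - c) * w by rewrite mulr_gt0 // subr_gt0.
move: H1 H2; rewrite !mulrBl !mul1r; lra.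
Qed.

(** The estimates give [(D - n) * h <= (D - n) * h / 2], against [n < D]. *)
Lemma super_arith (R : realType) (n D h S u1 u2 : R) : n < D -> 0 < h -> S <= n ->
  u2 + D * h <= u1 -> - ((D - n) * h / 2) <= u2 - u1 + h * S -> False.
Proof.
move=> nD h0 Sn H1 H2.
have : h * S <= h * n by rewrite ler_pM2l.
have : 0 < (D - n) * h by rewrite mulr_gt0 // subr_gt0.
move: H1 H2; rewrite !mulrBl; lra.
Qed.

(** Continuity of the product in [q]. The shift allows inverting the components of a subgradient,
    some of which may be 0. *)
Lemma prod_shift_lt (R : realType) (d : nat) (p : 'I_d -> R) (K : R) :
  \prod_i p i < K -> exists2 q, 0 < q & \prod_i (p i + q) < K.
Proof.
move=> pK.
have cp (s : seq 'I_d) :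
    \prod_(i <- s) (p i + q) @[q --> (0 : R)] --> \prod_(i <- s) p i.
  elim: s => [|i s IH].
    by under eq_fun do rewrite big_nil; rewrite big_nil; exact: cvg_cst.
  under eq_fun do rewrite big_cons; rewrite big_cons; apply: cvgM => //.
  by rewrite -[X in _ --> X]addr0; apply: cvgD; [exact: cvg_cst | exact: cvg_id].
have : \forall q \near (0 : R), \prod_i (p i + q) < K.
  by have /cvgr_lt := cp (index_enum 'I_d); apply.
move=> /nbhs_ballP[r /= r0 H].
exists (r / 2); first by rewrite divr_gt0.
by apply: H; rewrite /ball /= sub0r normrN gtr0_norm ?divr_gt0 //; lra.
Qed.

(** * Sub- and superdifferentials of the value function *)

Section Viscosity.
Context {R : realType} {d : nat}.
Implicit Types (g dg : R -> 'rV[R]_d) (t s a b : R) (x y p v : 'rV[R]_d).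
Variables (f : 'rV[R]_d -> R) (M : R).
Hypotheses (d_gt0 : (0 < d)%N) (fM : forall x, f x <= M)
  (f0 : forall x, 0 <= f x) (bf : borel_fun f).
Hypothesis supp : forall x, f x != 0 -> vle 0 x /\ vle x (const_mx 1).
Let i0 : 'I_d := Ordinal d_gt0.
Let w x := f x / d%:R ^+ d.

Let mono := @pareto_monotone_U R d f M d_gt0 fM f0 bf supp.

Let dR_gt0 : 0 < d%:R :> R. Proof. by rewrite ltr0n. Qed.
Let dd_gt0 : 0 < d%:R ^+ d :> R. Proof. by rewrite exprn_gt0. Qed.
Let dV_gt0 : 0 < d%:R^-1 :> R. Proof. by rewrite invr_gt0. Qed.

Let w_bounded x : `|w x| <= M / d%:R ^+ d.
Proof.
rewrite ger0_norm ?divr_ge0 ?f0 ?(ltW dd_gt0) // /w.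
by rewrite ler_pM2r ?invr_gt0.
Qed.

(** Explains the constant of the equation: the root of [d ^ d] offsets the [1 / d] from AM-GM. *)
Let powR_dd (K : R) : 0 <= K ->
  powR (K * d%:R ^+ d) d%:R^-1 = powR K d%:R^-1 * d%:R.
Proof.
move=> K0; rewrite powRM ?(ltW dd_gt0) //; congr (_ * _).
by rewrite -powR_mulrn ?(ltW dR_gt0) // -powRrM mulfV ?powRr1 ?gt_eqF // ltW.
Qed.

(** Otherwise [w <= K < \prod_i p 0 i] on a box around [x]. With weights [p], [dpp_upper] bounds
    [U f x - U f y] by [c * S] up to a small error, where [c < 1] and [S] is the product of [p] with
    [x - y]. The superdifferential makes the same difference at least [S] up to a small error. *)
Lemma prod_le_usc_env x p : superdiff (U f) x p ->
  \prod_i p 0 i <= usc_env w x.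
Proof.
move=> Hp; rewrite leNgt; apply/negP => /(usc_env_lt d_gt0 w_bounded)[r [K [r0 Kp wK]]].
have p_ge0 i := @superdiff_ge0 _ _ (U f) x p i mono Hp.
have K0 : 0 <= K.
  apply: le_trans (wK x _) => [|i]; last by rewrite subrr normr0 ltW.
  by rewrite divr_ge0 ?f0 ?(ltW dd_gt0).
have P0 : 0 < \prod_i p 0 i := le_lt_trans K0 Kp.
have p_gt0 i : 0 < p 0 i.
  rewrite lt_neqAle p_ge0 andbT eq_sym; apply: contraTneq P0 => E.
  by rewrite (bigD1 i) //= E mul0r ltxx.
have [m m0 mp] : exists2 m, 0 < m & forall i, m <= p 0 i.
  case: (@arg_minP _ _ _ i0 predT (fun i => p 0 i) isT) => i _ Hi.
  by exists (p 0 i) => // j; exact: Hi.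
pose c := powR K d%:R^-1 / powR (\prod_i p 0 i) d%:R^-1.
have L0 : 0 < powR (\prod_i p 0 i) d%:R^-1 by apply: powR_gt0.
have c1 : c < 1.
  by rewrite /c ltr_pdivrMr // mul1r; apply: gt0_ltr_powR => //; rewrite nnegrE // ltW.
(* As the Euclidean norm on the box is at most [d * h], this tolerance gives an error of at most
   [(1 - c) * (m * h) / 2]. *)
have del0 : 0 < (1 - c) * m / 2 / d%:R by rewrite !divr_gt0 // mulr_gt0 // subr_gt0.
have [r' r'0 Hr'] := near_box (Hp _ del0).
pose h := Num.min r r'.
have h0 : 0 < h by rewrite lt_min r0.
have hr : h <= r by rewrite ge_min lexx.
have hr' : h <= r' by rewrite ge_min lexx orbT.
have box y : (forall i, x 0 i - h <= y 0 i <= x 0 i) -> forall i, `|x 0 i - y 0 i| <= h.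
  move=> Hy i; have /andP[y1 y2] := Hy i.
  by rewrite ger0_norm ?subr_ge0 // lerBlDr addrC -lerBlDr.
have mh0 : 0 < m * h by rewrite mulr_gt0.
have e0 : 0 < (1 - c) * (m * h) / 4 by rewrite divr_gt0 // mulr_gt0 // subr_gt0.
have fN y : (forall i, x 0 i - h <= y 0 i <= x 0 i) -> f y <= K * d%:R ^+ d.
  move=> /box Hy; rewrite -ler_pdivrMr //; apply: wK => i.
  exact: le_trans (Hy i) hr.
have [y [yx [j yj]]] := dpp_upper d_gt0 fM f0 bf supp p_gt0 h0 e0 fN.
rewrite powR_dd // (_ : _ / d%:R = c); last by rewrite /c; field; rewrite !gt_eqF.
set S := \sum_i _ => Hy.
(* The point [y] is on a lower face of the box, so one coordinate alone contributes at least
   [m * h]. *)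
have whS : m * h <= S.
  rewrite /S (bigD1 j) //= -[leLHS]addr0; apply: lerD.
    by apply: ler_pM; rewrite ?(ltW m0) ?(ltW h0) // lerBrDr addrC -lerBrDr.
  apply: sumr_ge0 => i _; rewrite mulr_ge0 // subr_ge0.
  by have /andP[] := yx i.
have dS : dotv p (y - x) = - S.
  rewrite /dotv /S -sumrN; apply: eq_bigr => i _.
  by rewrite !mxE -mulrN opprB.
have Hs : U f y - U f x + S <= (1 - c) * (m * h) / 2.
  have := Hr' y (fun i => le_trans (box y yx i) hr').
  rewrite dS opprK => /le_trans; apply.
  apply: le_trans (ler_wpM2l (ltW del0) (enorm_le (ltW h0) _)) _ => [i|].
    by rewrite !mxE distrC; exact: box.
  by rewrite le_eqVlt; apply/predU1P; left; field; rewrite gt_eqF.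
exact: sub_arith c1 mh0 whS Hy Hs.
Qed.

(** Otherwise [w >= K > \prod_i p 0 i] on a box around [x]. Pushing along [h *: v] then gains at
    least [D * h] with [D > d], whereas the subdifferential at [x - h v] allows a gain of at most
    [d * h] up to a small error. *)
Lemma lsc_env_le_prod x p : subdiff (U f) x p ->
  lsc_env w x <= \prod_i p 0 i.
Proof.
move=> Hp; rewrite leNgt /lsc_env ltrNr; apply/negP.
have wN y : `|- w y| <= M / d%:R ^+ d by rewrite normrN.
move=> /(usc_env_lt d_gt0 wN)[r [K' [r0 Kp wK]]].
have p_ge0 i := @subdiff_ge0 _ _ (U f) x p i mono Hp.
pose K := - K'.
have {}Kp : \prod_i p 0 i < K by rewrite /K ltrNr.
have {}wK y : (forall i, `|x 0 i - y 0 i| <= r) -> K <= w y.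
  by move=> /wK; rewrite /K lerNl.
have K0 : 0 < K by apply: le_lt_trans Kp; exact: prodr_ge0.
have [q q0 QK] := prod_shift_lt Kp.
(* This direction nearly equalises the terms [p_i v_i], the equality case of AM-GM; each is at most
   1, so their sum is at most [d]. *)
pose v : 'rV[R]_d := \row_i (p 0 i + q)^-1.
have pq i : 0 < p 0 i + q by rewrite ltr_wpDl.
have v_gt0 i : 0 < v 0 i by rewrite mxE invr_gt0.
have v_le i : v 0 i <= q^-1 by rewrite mxE lef_pV2 ?posrE // lerDr.
have V0 : 0 < q^-1 by rewrite invr_gt0.
pose D := powR (K * d%:R ^+ d) d%:R^-1 * powR (\prod_i v 0 i) d%:R^-1.
have dD : d%:R < D.
  have Pv : \prod_i v 0 i = (\prod_i (p 0 i + q))^-1.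
    by rewrite -prodfV; apply: eq_bigr => i _; rewrite mxE.
  have Q0 : 0 < \prod_i (p 0 i + q) by apply: prodr_gt0.
  rewrite /D powR_dd ?(ltW K0) // mulrAC -powRM ?(ltW K0) //; last first.
    by rewrite Pv invr_ge0 ltW.
  rewrite -[ltLHS]mul1r ltr_pM2r // Pv.
  rewrite -[ltLHS](congr1 (fun F => F d%:R^-1) (@powR1 R)).
  apply: gt0_ltr_powR => //; rewrite ?nnegrE ?divr_ge0 ?(ltW K0) ?(ltW Q0) //.
  by rewrite ltr_pdivlMr // mul1r.
have eps0 : 0 < (D - d%:R) / 2 / (d%:R * q^-1).
  by rewrite divr_gt0 ?mulr_gt0 ?invr_gt0 // subr_gt0.
have [r' r'0 Hr'] := near_box (Hp _ eps0).
(* Since [v 0 i <= q^-1], the box down to [x - 2 h v] stays within [r] of [x], and [x - h v] within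
   [r']. *)
have [h [h0 hr hr']] : exists h, [/\ 0 < h, 2 * h * q^-1 <= r & h * q^-1 <= r'].
  exists (Num.min (r / 2) r' * q); split.
  - by rewrite mulr_gt0 // lt_min r'0 divr_gt0.
  - rewrite mulrA mulfK ?gt_eqF // mulrC -ler_pdivlMr //.
    by rewrite ge_min lexx.
  - by rewrite mulfK ?gt_eqF // ge_min lexx orbT.
have fN y : (forall i, x 0 i - 2 * h * v 0 i <= y 0 i <= x 0 i) ->
    K * d%:R ^+ d <= f y.
  move=> Hy; rewrite -ler_pdivlMr //; apply: wK => i.
  have /andP[y1 y2] := Hy i.
  rewrite ger0_norm ?subr_ge0 //; apply: le_trans hr.
  apply: (@le_trans _ _ (2 * h * v 0 i)); first by rewrite lerBlDr addrC -lerBlDr.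
  by rewrite (ler_pM2l (mulr_gt0 (ltr0Sn R 1) h0)); exact: v_le.
have N0 : 0 <= K * d%:R ^+ d by rewrite mulr_ge0 ?(ltW K0) ?(ltW dd_gt0).
have Hy := dpp_lower d_gt0 fM f0 bf supp v_gt0 h0 N0 fN.
rewrite -/D in Hy.
set y := x - h *: v in Hy.
have xy i : `|x 0 i - y 0 i| <= h * q^-1.
  rewrite /y !mxE opprB addrC subrK.
  rewrite ger0_norm ?mulr_ge0 ?invr_ge0 ?(ltW h0) ?(ltW (pq i)) //.
  by rewrite (ler_pM2l h0); have := v_le i; rewrite mxE.
pose S := \sum_i p 0 i * v 0 i.
have Sd : S <= d%:R.
  have -> : d%:R = \sum_(i < d) 1 :> R by rewrite sumr_const card_ord.
  apply: ler_sum => j _.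
  by rewrite mxE ler_pdivrMr // mul1r lerDl ltW.
have dS : dotv p (y - x) = - (h * S).
  rewrite /dotv /S mulr_sumr -sumrN; apply: eq_bigr => j _.
  by rewrite /y !mxE; ring.
have Hs : - ((D - d%:R) * h / 2) <= U f y - U f x + h * S.
  have := Hr' y (fun i => le_trans (xy i) hr').
  rewrite dS opprK; apply: le_trans; rewrite lerN2.
  have hq0 : 0 <= h * q^-1 by rewrite mulr_ge0 // ltW.
  apply: le_trans (ler_wpM2l (ltW eps0) (enorm_le hq0 _)) _ => [j|].
    by rewrite !mxE distrC; have := xy j; rewrite /y !mxE.
  by rewrite le_eqVlt; apply/predU1P; left; field; rewrite !gt_eqF.
exact: super_arith dD h0 Sd Hy Hs.
Qed.

Lemma viscosity_U : viscosity_solution (U f) w setT.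
Proof.
split; [exact: continuous_U d_gt0 fM f0 bf supp | exact: openT | move=> x _].
by split=> p; [exact: prod_le_usc_env | exact: lsc_env_le_prod].
Qed.

End Viscosity.

Unset Implicit Arguments.

(** Finiteness of [Uext] is part of the conclusion because [U] is its [fine] part, which would be 0
    at an infinite value. *)
Theorem theorem2p6 (R : realType) (d : nat) (f : 'rV[R]_d -> R) :
  (2 <= d)%N ->
  sup_bounded f ->
  borel_fun f ->
  (forall x, 0 <= f x) ->
  [set x | f x != 0] `<=` [set x | vle 0 x /\ vle x (const_mx 1)] ->
  [/\ (forall x, Uext f x \is a fin_num),
      pareto_monotone (U f),
      viscosity_solution (U f) (fun x => f x / (d%:R ^+ d)) setT,
      (forall z : 'rV[R]_d,
         [set x | f x != 0] `<=` [set x | vle 0 x /\ vle x z] ->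
         forall x, posorthant x -> U f x = U f (vmin x z)) &
      (forall x, ~ posorthant x -> U f x = 0)].
Proof.
move=> d2 [M fM'] bf f0 supp.
have d_gt0 : (0 < d)%N by apply: ltn_trans d2.
have fM x : f x <= M by apply: le_trans (fM' x); exact: ler_norm.
split.
- exact: Uext_fin_num d_gt0 fM f0 bf supp.
- exact: pareto_monotone_U d_gt0 fM f0 bf supp.
- exact: viscosity_U d_gt0 fM f0 bf supp.
- move=> z suppz x _; apply: (U_vmin d_gt0 fM f0 bf supp) => y yz.
  exact: (suppz y yz).2.
- move=> x; exact: U_out_posorthant d_gt0 fM f0 bf supp x.
Qed.
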